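(* Let $n,r$ be positive integers, $\mathfrak g=\mathfrak{so}_{2n+1}$, $\varrho=q^{2n}$, and let $V$ be the natural representation of $\mathbf U_\kappa(\mathfrak{so}_{2n+1})$. Then $V^{\otimes r}\cong(V^{\otimes r})^*$ as $(\mathbf U_\kappa(\mathfrak{so}_{2n+1}),\mathcal B_r(\varrho,q))$-bimodules, where on the linear dual $(V^{\otimes r})^*$ the actions are $(u\phi)(x)=\phi(S(u)x)$ for $u\in\mathbf U_\kappa(\mathfrak{so}_{2n+1})$, with $S$ the antipode, and $(\phi b)(x)=\phi(x\tilde\sigma(b))$ for $b\in\mathcal B_r(\varrho,q)$, with $\tilde\sigma$ the $\kappa$-linear anti-involution of $\mathcal B_r(\varrho,q)$ such that $\tilde\sigma(T_i)=T_{r-i}$ and $\tilde\sigma(E_i)=E_{r-i}$, $1\le i\le r-1$.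
   Context: **Quantum group of type $\mathfrak{so}_{2n+1}$.** Let $\epsilon_1,\dots,\epsilon_n$ be orthonormal for $(\ ,\ )$, $\alpha_i=\epsilon_i-\epsilon_{i+1}$ $(i<n)$, $\alpha_n=\epsilon_n$, $a_{ij}=2(\alpha_i,\alpha_j)/(\alpha_i,\alpha_i)$, $d_i=2$ $(i<n)$, $d_n=1$. Let $v$ be an indeterminate, $[m]^!_d=\prod_{i=1}^m\frac{v^{di}-v^{-di}}{v^d-v^{-d}}$. $U_v$ is the $\mathbb Q(v)$-algebra generated by $e_i,f_i,k_i^{\pm1}$ $(1\le i\le n)$ with relations: the $k_i^{\pm 1}$ commute, $k_ik_i^{-1}=1$, $k_ie_jk_i^{-1}=v^{d_ia_{ij}}e_j$, $k_if_jk_i^{-1}=v^{-d_ia_{ij}}f_j$, $e_if_j-f_je_i=\delta_{ij}\frac{k_i-k_i^{-1}}{v^{d_i}-v^{-d_i}}$, and the usual quantum Serre relations. Hopf structure: $\Delta(e_i)=e_i\otimes1+k_i\otimes e_i$, $\Delta(f_i)=f_i\otimes k_i^{-1}+1\otimes f_i$, $\Delta(k_i)=k_i\otimes k_i$; antipode $S(e_i)=-k_i^{-1}e_i$, $S(f_i)=-f_ik_i$, $S(k_i)=k_i^{-1}$. With $\mathcal A=\mathbb Z[v,v^{-1}]$, $\mathbf U$ is the $\mathcal A$-subalgebra generated by the divided powers $e_i^{(k)}=e_i^k/[k]^!_{d_i}$, $f_i^{(k)}=f_i^k/[k]^!_{d_i}$ and $k_i^{\pm1}$. $\kappa$ is a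 field containing nonzero $q$ and a fixed square root $q^{1/2}$ of it, with $q^2\ne1$, viewed as an $\mathcal A$-algebra by $v\mapsto q^{1/2}$; $\mathbf U_\kappa(\mathfrak{so}_{2n+1})=\mathbf U\otimes_{\mathcal A}\kappa$. **Natural representation.** $V=\bigoplus_{i=1}^{2n+1}\kappa v_i$, $i'=2n+2-i$, $[2]=q^{1/2}+q^{-1/2}$. For $i<n$: $e_iv_{i+1}=v_i$, $e_iv_{i'}=-v_{(i+1)'}$; $f_iv_i=v_{i+1}$, $f_iv_{(i+1)'}=-v_{i'}$; $k_iv_k=qv_k$ for $k\in\{i,(i+1)'\}$, $k_iv_k=q^{-1}v_k$ for $k\in\{i+1,i'\}$. Also $e_nv_{n+1}=v_n$, $e_nv_{n'}=-q^{-1/2}v_{n+1}$, $f_nv_n=[2]v_{n+1}$, $f_nv_{n+1}=-q^{1/2}[2]v_{n'}$, $k_nv_n=qv_n$, $k_nv_{n'}=q^{-1}v_{n'}$. In all unlisted cases $e_i,f_i$ act by $0$ and $k_i$ by $1$. Divided powers with $k\ge2$ act by base change from generic $v$: as $0$, except $e_n^{(2)}v_{n'}=-q^{-1/2}[2]^{-1}v_n$, $f_n^{(2)}v_n=-q^{1/2}[2]v_{n'}$. **BMW algebra.** $\mathcal B_r(\varrho,q)$ is the unital associative $\kappa$-algebra generated by $T_i,E_i$ $(1\le i\le r-1)$ with relations $(T_i-q)(T_i+q^{-1})(T_i-\varrho^{-1})=0$; $T_iT_{i+1}T_i=T_{i+1}T_iT_{i+1}$; $T_iT_j=T_jT_i$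 for $|i-j|>1$; $E_iT_j^{\pm1}E_i=\varrho^{\pm1}E_i$ for $j=i\pm1$; $E_iT_i=T_iE_i=\varrho^{-1}E_i$; where $T_i-T_i^{-1}=(q-q^{-1})(1-E_i)$. **Right action on $V^{\otimes r}$.** $T_i$ and $E_i$ act as $\breve R$ and $E$ on tensor factors $i,i+1$. Let $\rho=(\rho_1,\dots,\rho_{2n+1})=(n-\frac12,\dots,\frac12,0,-\frac12,\dots,\frac12-n)$, $\delta=q-q^{-1}$. For $(k,\ell)\ne(n+1,n+1)$, $(v_k\otimes v_\ell)\breve R$ equals: $qv_k\otimes v_k$ if $k=\ell$; $v_\ell\otimes v_k$ if $k>\ell$, $k\ne\ell'$; $q^{-1}v_\ell\otimes v_k-\delta\sum_{i>k}q^{\rho_i-\rho_k}v_{i'}\otimes v_i$ if $k>\ell$, $k=\ell'$; $v_\ell\otimes v_k+\delta v_k\otimes v_\ell$ if $k<\ell$, $k\neq\ell'$; $q^{-1}v_\ell\otimes v_k+\delta\big(v_k\otimes v_\ell-\sum_{i>k}q^{\rho_i-\rho_k}v_{i'}\otimes v_i\big)$ if $k<\ell$, $k=\ell'$; and $(v_{n+1}\otimes v_{n+1})\breve R=v_{n+1}\otimes v_{n+1}-\delta\sum_{i>n+1}q^{\rho_i}v_{i'}\otimes v_i$. Also $(v_k\otimes v_\ell)E=\sum_{i=1}^{2n+1}q^{\rho_{i'}-\rho_k}v_i\otimes v_{i'}$ if $k=\ell'$ and $0$ otherwise. *)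

(* Defs.v *)
From HB Require Import structures.
From mathcomp Require Import all_boot all_order all_algebra.
From mathcomp Require Import generic_quotient.
From mathcomp Require Import boolp.

Set Implicit Arguments.
Unset Strict Implicit.
Unset Printing Implicit Defensive.

Import Order.TTheory GRing.Theory Num.Theory.
Local Open Scope ring_scope.
Local Open Scope quotient_scope.

(** Unital associative algebras over a field, given by their structure maps.
    Unlike [algType], the structure does not require [1 != 0], so that every
    presentation defines one. *)

HB.mixin Record hasStructureMap (K : fieldType) A of GRing.PzRing A := {
  cst : K -> A;
  cst_zmod_morphism : zmod_morphism cst;
  cst_monoid_morphism : monoid_morphism cst;
  cst_central : forall a (x : A), cst a * x = x * cst a
}.

#[short(type="pzAlgType")]
HB.structure Definition PzAlg (K : fieldType) :=
  {A of GRing.PzRing A & hasStructureMap K A}.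

Notation "a **: x" := (cst a * x) (at level 40) : ring_scope.

Definition alg_hom (K : fieldType) (A B : pzAlgType K) (f : A -> B) : Prop :=
  [/\ forall a, f (cst a) = cst a, forall x y, f (x + y) = f x + f y &
      forall x y, f (x * y) = f x * f y].

Definition alg_antihom (K : fieldType) (A B : pzAlgType K) (f : A -> B) : Prop :=
  [/\ forall a, f (cst a) = cst a, forall x y, f (x + y) = f x + f y &
      forall x y, f (x * y) = f y * f x].

Definition left_module (K : fieldType) (A : pzAlgType K) (M : lmodType K)
    (L : A -> M -> M) : Prop :=
  [/\ forall a, linear (L a), forall c x, L (cst c) x = c *: x,
      forall a b x, L (a + b) x = L a x + L b x &
      forall a b x, L (a * b) x = L a (L b x)].

Definition right_module (K : fieldType) (A : pzAlgType K) (M : lmodType K)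
    (R : M -> A -> M) : Prop :=
  [/\ forall a, linear (R^~ a), forall c x, R x (cst c) = c *: x,
      forall a b x, R x (a + b) = R x a + R x b &
      forall a b x, R x (a * b) = R (R x a) b].

(** The algebra presented by generators [X] and relations [sat], where
    [sat B x] says that the family [x] of elements of the algebra [B]
    satisfies the relations. Two words in the generators are identified when
    they agree in every algebra satisfying the relations; for equational
    relations this is the congruence which the relations generate. *)

Inductive term (K X : Type) :=
  | TGen of X
  | TConst of K
  | TAdd of term K X & term K X
  | TMul of term K X & term K X.

Fixpoint eval (K : fieldType) (X : Type) (B : pzAlgType K) (x : X -> B)
    (t : term K X) : B :=
  match t with
  | TGen i => x i
  | TConst a => cst a
  | TAdd t1 t2 => eval x t1 + eval x t2
  | TMul t1 t2 => eval x t1 * eval x t2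
  end.

HB.instance Definition _ (K X : Type) := gen_eqMixin (term K X).
HB.instance Definition _ (K X : Type) := gen_choiceMixin (term K X).

Section Presentation.
Variables (K : fieldType) (X : Type).
Variable sat : forall B : pzAlgType K, (X -> B) -> Prop.

Definition same_value (t1 t2 : term K X) : bool :=
  `[< forall (B : pzAlgType K) (x : X -> B), sat x -> eval x t1 = eval x t2 >].

Fact same_value_refl : reflexive same_value.
Proof. by move=> t; apply/asboolP. Qed.

Fact same_value_sym : symmetric same_value.
Proof.
by move=> t1 t2; apply/asboolP/asboolP => h B x hx; rewrite (h B x hx).
Qed.

Fact same_value_trans : transitive same_value.
Proof.
move=> t2 t1 t3 /asboolP h12 /asboolP h23; apply/asboolP => B x hx.
by rewrite (h12 B x hx) (h23 B x hx).
Qed.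

Canonical same_value_equiv :=
  EquivRel same_value same_value_refl same_value_sym same_value_trans.

Definition presented : Type := {eq_quot same_value_equiv}.
HB.instance Definition _ := Choice.on presented.
HB.instance Definition _ := EqQuotient.on presented.

Definition pgen (i : X) : presented := \pi_presented (TGen K i).

Lemma eval_repr (B : pzAlgType K) (x : X -> B) (t : term K X) :
  sat x -> eval x (repr (\pi_presented t)) = eval x t.
Proof.
move=> hx; have /eqquotP/asboolP h : repr (\pi_presented t) = t %[mod presented].
  by rewrite reprK.
exact: h.
Qed.

Lemma presented_ext (u w : presented) :
    (forall (B : pzAlgType K) (x : X -> B), sat x ->
       eval x (repr u) = eval x (repr w)) ->
  u = w.
Proof.
move=> h; rewrite -(reprK u) -(reprK w).
by apply/eqquotP/asboolP.
Qed.

Definition pzero : presented := \pi_presented (TConst X 0).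
Definition pone : presented := \pi_presented (TConst X 1).
Definition padd (u w : presented) : presented := \pi_presented (TAdd (repr u) (repr w)).
Definition pmul (u w : presented) : presented := \pi_presented (TMul (repr u) (repr w)).
Definition popp (u : presented) : presented :=
  \pi_presented (TMul (TConst X (-1)) (repr u)).
Definition pcst (a : K) : presented := \pi_presented (TConst X a).

Local Ltac by_eval :=
  let B := fresh "B" in let x := fresh "x" in let hx := fresh "hx" in
  apply: presented_ext; intros B x hx; rewrite ?(eval_repr _ hx) /=;
  rewrite ?(eval_repr _ hx) /=.

Fact cst0 (B : pzAlgType K) : cst 0 = 0 :> B.
Proof. by have := cst_zmod_morphism (s := B) 0 0; rewrite !subrr. Qed.
Fact cst1 (B : pzAlgType K) : cst 1 = 1 :> B.
Proof. by have [] := cst_monoid_morphism (s := B). Qed.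
Fact cstN1 (B : pzAlgType K) : cst (-1) = -1 :> B.
Proof.
by have := cst_zmod_morphism (s := B) 0 1; rewrite !sub0r cst0 cst1 sub0r.
Qed.

Fact paddA : associative padd.
Proof. by move=> u w z; by_eval; rewrite addrA. Qed.
Fact paddC : commutative padd.
Proof. by move=> u w; by_eval; rewrite addrC. Qed.
Fact padd0 : left_id pzero padd.
Proof. by move=> u; by_eval; rewrite cst0 add0r. Qed.
Fact paddN : left_inverse pzero popp padd.
Proof. by move=> u; by_eval; rewrite cstN1 mulN1r addNr cst0. Qed.
Fact pmulA : associative pmul.
Proof. by move=> u w z; by_eval; rewrite mulrA. Qed.
Fact pmul1 : left_id pone pmul.
Proof. by move=> u; by_eval; rewrite cst1 mul1r. Qed.
Fact pmulr1 : right_id pone pmul.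
Proof. by move=> u; by_eval; rewrite cst1 mulr1. Qed.
Fact pmulDl : left_distributive pmul padd.
Proof. by move=> u w z; by_eval; rewrite mulrDl. Qed.
Fact pmulDr : right_distributive pmul padd.
Proof. by move=> u w z; by_eval; rewrite mulrDr. Qed.

HB.instance Definition _ :=
  GRing.isZmodule.Build presented paddA paddC padd0 paddN.
HB.instance Definition _ :=
  GRing.Zmodule_isPzRing.Build presented pmulA pmul1 pmulr1 pmulDl pmulDr.

Fact pcst_zmod_morphism : zmod_morphism pcst.
Proof.
move=> a b; apply: presented_ext => B x hx.
rewrite !(eval_repr _ hx) /= (eval_repr (TConst X a) hx).
rewrite (eval_repr (TMul _ _) hx) /= (eval_repr (TConst X b) hx) /=.
by rewrite cstN1 mulN1r cst_zmod_morphism.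
Qed.
Fact pcst_monoid_morphism : monoid_morphism pcst.
Proof.
split=> [|a b]; apply: presented_ext => B x hx; rewrite !(eval_repr _ hx) //=.
rewrite (eval_repr (TConst X a) hx) (eval_repr (TConst X b) hx) /=.
by have [_ ->] := cst_monoid_morphism (s := B).
Qed.
Fact pcst_central (a : K) (u : presented) : pcst a * u = u * pcst a.
Proof. by by_eval; rewrite cst_central. Qed.

HB.instance Definition _ := hasStructureMap.Build K presented
  pcst_zmod_morphism pcst_monoid_morphism pcst_central.

End Presentation.

Arguments pgen {K X sat}.

(** The tensor product of algebras, presented as the algebra generated by
    commuting copies of its two factors. *)

Definition tensor_rel (K : fieldType) (A1 A2 : pzAlgType K) (B : pzAlgType K)
    (x : A1 + A2 -> B) : Prop :=
  [/\ alg_hom (fun a => x (inl a)), alg_hom (fun a => x (inr a)) &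
      forall a1 a2, x (inl a1) * x (inr a2) = x (inr a2) * x (inl a1)].

Definition tensor_alg (K : fieldType) (A1 A2 : pzAlgType K) : pzAlgType K :=
  presented (@tensor_rel K A1 A2).

Definition tensor (K : fieldType) (A1 A2 : pzAlgType K) (a1 : A1) (a2 : A2) :
    tensor_alg A1 A2 :=
  pgen (inl a1) * pgen (inr a2).

Definition Qv : fieldType := {fraction {poly rat}}.
Definition vq : Qv := tofrac 'X.

Definition qfact (d m : nat) : Qv :=
  \prod_(1 <= t < m.+1) ((vq ^+ (d * t) - vq ^- (d * t)) / (vq ^+ d - vq ^- d)).

Definition qbinom (d m s : nat) : Qv :=
  qfact d m / (qfact d s * qfact d (m - s)).

(** The value at [x] of the Laurent polynomial [v^-m p(v)]; every element of
    Z[v, v^-1] has this form. *)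
Definition laurent (E : fieldType) (x : E) (p : {poly int}) (m : nat) : E :=
  (map_poly intr p).[x] / x ^+ m.

(** The root datum of type B_n. The node [i : 'I_n] carries the label [i.+1]:
    [simple_root i k] is the coordinate of the corresponding simple root on the
    [k]-th basis vector. *)

Definition simple_root (n : nat) (i k : 'I_n) : int :=
  (k == i)%:R - (k == i.+1 :> nat)%:R.

Definition root_form (n : nat) (i j : 'I_n) : int :=
  \sum_k simple_root i k * simple_root j k.

Definition cartan (n : nat) (i j : 'I_n) : int :=
  ((2 * root_form i j) %/ root_form i i)%Z.

Definition dsym (n : nat) (i : 'I_n) : nat := if (i.+1 < n)%N then 2 else 1.

Variant Ugen (n : nat) :=
  | GenE of 'I_n
  | GenF of 'I_n
  | GenK of 'I_n
  | GenKV of 'I_n.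

Definition serre (n : nat) (B : pzAlgType Qv) (x : 'I_n -> B) (i j : 'I_n) : B :=
  let m := `|1 - cartan i j|%N in
  \sum_(s < m.+1)
    ((-1) ^+ s * qbinom (dsym i) m s) **: (x i ^+ (m - s) * x j * x i ^+ s).

Record U_rel (n : nat) (B : pzAlgType Qv) (x : Ugen n -> B) : Prop := {
  U_relKK : forall i j, x (GenK i) * x (GenK j) = x (GenK j) * x (GenK i);
  U_relKKV : forall i j, x (GenK i) * x (GenKV j) = x (GenKV j) * x (GenK i);
  U_relKVKV : forall i j, x (GenKV i) * x (GenKV j) = x (GenKV j) * x (GenKV i);
  U_relKV : forall i, x (GenK i) * x (GenKV i) = 1;
  U_relKE : forall i j, x (GenK i) * x (GenE j) * x (GenKV i) =
    vq ^ ((dsym i)%:Z * cartan i j) **: x (GenE j);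
  U_relKF : forall i j, x (GenK i) * x (GenF j) * x (GenKV i) =
    vq ^ (- ((dsym i)%:Z * cartan i j)) **: x (GenF j);
  U_relEF : forall i j, x (GenE i) * x (GenF j) - x (GenF j) * x (GenE i) =
    if i == j then
      (vq ^+ dsym i - vq ^- dsym i)^-1 **: (x (GenK i) - x (GenKV i))
    else 0;
  U_serreE : forall i j, i != j -> serre (fun k => x (GenE k)) i j = 0;
  U_serreF : forall i j, i != j -> serre (fun k => x (GenF k)) i j = 0
}.

Definition Uv (n : nat) : pzAlgType Qv := presented (@U_rel n).

Definition eU (n : nat) (i : 'I_n) : Uv n := pgen (GenE i).
Definition fU (n : nat) (i : 'I_n) : Uv n := pgen (GenF i).
Definition kU (n : nat) (i : 'I_n) : Uv n := pgen (GenK i).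
Definition kVU (n : nat) (i : 'I_n) : Uv n := pgen (GenKV i).

Definition e_divpow (n : nat) (i : 'I_n) (m : nat) : Uv n :=
  (qfact (dsym i) m)^-1 **: eU i ^+ m.
Definition f_divpow (n : nat) (i : 'I_n) (m : nat) : Uv n :=
  (qfact (dsym i) m)^-1 **: fU i ^+ m.

Inductive integral (n : nat) : Uv n -> Prop :=
  | integral1 : integral 1
  | integralB u w : integral u -> integral w -> integral (u - w)
  | integralM u w : integral u -> integral w -> integral (u * w)
  | integralZ p m u : integral u -> integral (laurent vq p m **: u)
  | integral_e i m : integral (e_divpow i m)
  | integral_f i m : integral (f_divpow i m)
  | integral_k i : integral (kU i)
  | integral_kV i : integral (kVU i).

Definition integral_pred (n : nat) : {pred Uv n} := fun u => `[< integral u >].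

Fact integral_subring (n : nat) : subring_closed (@integral_pred n).
Proof.
split=> [|u w|u w]; first exact/asboolP/integral1.
- by move=> /asboolP hu /asboolP hw; apply/asboolP/integralB.
- by move=> /asboolP hu /asboolP hw; apply/asboolP/integralM.
Qed.

Record Uint (n : nat) :=
  UintSub { uint_val : Uv n; uint_valP : uint_val \in @integral_pred n }.

HB.instance Definition _ (n : nat) := [isSub for @uint_val n].
HB.instance Definition _ (n : nat) := [Choice of Uint n by <:].
HB.instance Definition _ (n : nat) := 
  GRing.SubChoice_isSubPzRing.Build _ _ (Uint n) (@integral_subring n).

Definition e_int (n : nat) (i : 'I_n) (m : nat) : Uint n :=
  UintSub (introT (asboolP _) (integral_e i m)).
Definition f_int (n : nat) (i : 'I_n) (m : nat) : Uint n :=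
  UintSub (introT (asboolP _) (integral_f i m)).
Definition k_int (n : nat) (i : 'I_n) : Uint n :=
  UintSub (introT (asboolP _) (integral_k i)).

(** [Uk] is the tensor product of the integral form with [kappa] over Z[v, v^-1],
    where v acts on [kappa] as the square root [qh] of q: the algebra over
    [kappa] presented by the elements u (x) 1. *)

Record base_change_rel (kappa : fieldType) (qh : kappa) (n : nat)
    (B : pzAlgType kappa) (x : Uint n -> B) : Prop := {
  base_change_relD : forall u w, x (u + w) = x u + x w;
  base_change_relM : forall u w, x (u * w) = x u * x w;
  base_change_rel1 : x 1 = 1;
  base_change_relZ : forall p m u w, val w = laurent vq p m **: val u ->
    x w = laurent qh p m **: x u
}.

Definition Uk (kappa : fieldType) (qh : kappa) (n : nat) : pzAlgType kappa :=
  presented (@base_change_rel kappa qh n).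

Definition base_change (kappa : fieldType) (qh : kappa) (n : nat) (u : Uint n) :
    Uk qh n :=
  pgen u.

(** The Hopf structure. Since the divided powers and the [k_i^{+-1}] are mapped
    by the generic coproduct and antipode to (sums of tensors of) integral
    elements, the conditions below determine the coproduct and the antipode of
    the base change. *)

Record generic_coproduct (n : nat) (D : Uv n -> tensor_alg (Uv n) (Uv n)) :
    Prop := {
  generic_coproduct_hom : alg_hom D;
  generic_coproduct_e : forall i, D (eU i) = tensor (eU i) 1 + tensor (kU i) (eU i);
  generic_coproduct_f : forall i, D (fU i) = tensor (fU i) (kVU i) + tensor 1 (fU i);
  generic_coproduct_k : forall i, D (kU i) = tensor (kU i) (kU i)
}.

Record generic_antipode (n : nat) (S : Uv n -> Uv n) : Prop := {
  generic_antipode_antihom : alg_antihom S;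
  generic_antipode_e : forall i, S (eU i) = - (kVU i * eU i);
  generic_antipode_f : forall i, S (fU i) = - (fU i * kU i);
  generic_antipode_k : forall i, S (kU i) = kVU i
}.

Definition is_coproduct (kappa : fieldType) (qh : kappa) (n : nat)
    (D : Uk qh n -> tensor_alg (Uk qh n) (Uk qh n)) : Prop :=
  alg_hom D /\
  exists2 Dv, @generic_coproduct n Dv &
    forall (u : Uint n) (s : seq (Uint n * Uint n)),
      Dv (val u) = \sum_(p <- s) tensor (val p.1) (val p.2) ->
      D (base_change qh u) =
        \sum_(p <- s) tensor (base_change qh p.1) (base_change qh p.2).

Definition is_antipode (kappa : fieldType) (qh : kappa) (n : nat)
    (S : Uk qh n -> Uk qh n) : Prop :=
  alg_antihom S /\
  exists2 Sv, @generic_antipode n Sv &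
    forall u w : Uint n, val w = Sv (val u) ->
      S (base_change qh u) = base_change qh w.

(** The space [V^{(x) s}], where [V = kappa^(2n+1)]: a tensor is given by its
    coordinates on the products of basis vectors, and [V] itself is the case
    [s = 1]. *)

Definition tpow (kappa : fieldType) (n s : nat) : vectType kappa :=
  {ffun {ffun 'I_s -> 'I_n.*2.+1} -> kappa^o}.

Definition tbasis (kappa : fieldType) (n s : nat) (k : {ffun 'I_s -> 'I_n.*2.+1}) :
    tpow kappa n s :=
  [ffun l => (l == k)%:R].

Definition tcat (kappa : fieldType) (n s t : nat)
    (x : tpow kappa n s) (y : tpow kappa n t) : tpow kappa n (s + t) :=
  [ffun k : {ffun 'I_(s + t) -> 'I_n.*2.+1} =>
    x [ffun i => k (lshift t i)] * y [ffun j => k (rshift s j)]].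

(** In [vb], [prm], [e_act], [f_act], [k_act] and their divided powers, nodes
    and basis vectors are designated by their labels, which start from 1. *)

Section NaturalRepresentation.
Variables (kappa : fieldType) (n : nat) (q qh : kappa).

Definition vb (j : nat) : tpow kappa n 1 := tbasis kappa [ffun=> inord j.-1].
Definition prm (j : nat) : nat := (n.*2.+2 - j)%N.
Definition qint2 : kappa := qh + qh^-1.

Definition e_act (i j : nat) : tpow kappa n 1 :=
  if (i < n)%N then
    if j == i.+1 then vb i
    else if j == prm i then - vb (prm i.+1)
    else 0
  else
    if j == n.+1 then vb n
    else if j == prm n then - (qh^-1 *: vb n.+1)
    else 0.

Definition f_act (i j : nat) : tpow kappa n 1 :=
  if (i < n)%N then
    if j == i then vb i.+1
    else if j == prm i.+1 then - vb (prm i)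
    else 0
  else
    if j == n then qint2 *: vb n.+1
    else if j == n.+1 then - ((qh * qint2) *: vb (prm n))
    else 0.

Definition k_act (i j : nat) : kappa :=
  if (i < n)%N then
    if (j == i) || (j == prm i.+1) then q
    else if (j == i.+1) || (j == prm i) then q^-1
    else 1
  else
    if j == n then q
    else if j == prm n then q^-1
    else 1.

Definition e_divpow_act (i m j : nat) : tpow kappa n 1 :=
  match m with
  | 0 => vb j
  | 1 => e_act i j
  | 2 => if (i == n) && (j == prm n) then - ((qh^-1 * qint2^-1) *: vb n) else 0
  | _ => 0
  end.

Definition f_divpow_act (i m j : nat) : tpow kappa n 1 :=
  match m with
  | 0 => vb j
  | 1 => f_act i j
  | 2 => if (i == n) && (j == n) then - ((qh * qint2) *: vb (prm n)) else 0
  | _ => 0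
  end.

Record natural_rep (L : Uk qh n -> tpow kappa n 1 -> tpow kappa n 1) : Prop := {
  natural_rep_module : left_module L;
  natural_rep_e : forall (i : 'I_n) m j, (0 < j <= n.*2.+1)%N ->
    L (base_change qh (e_int i m)) (vb j) = e_divpow_act i.+1 m j;
  natural_rep_f : forall (i : 'I_n) m j, (0 < j <= n.*2.+1)%N ->
    L (base_change qh (f_int i m)) (vb j) = f_divpow_act i.+1 m j;
  natural_rep_k : forall (i : 'I_n) j, (0 < j <= n.*2.+1)%N ->
    L (base_change qh (k_int i)) (vb j) = k_act i.+1 j *: vb j
}.

End NaturalRepresentation.

(** The modules [V^{(x) s}], [s > 0], built from [V^{(x) 1}] with a coproduct [D];
    no parenthesization is singled out, [D] being coassociative. *)
Definition tensor_power_modules (kappa : fieldType) (qh : kappa) (n : nat)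
    (D : Uk qh n -> tensor_alg (Uk qh n) (Uk qh n))
    (L : forall s, Uk qh n -> tpow kappa n s -> tpow kappa n s) : Prop :=
  (forall s, (0 < s)%N -> left_module (L s)) /\
  (forall s t, (0 < s)%N -> (0 < t)%N ->
    forall u (ps : seq (Uk qh n * Uk qh n)),
      D u = \sum_(p <- ps) tensor p.1 p.2 ->
    forall x y,
      L (s + t)%N u (tcat x y) = \sum_(p <- ps) tcat (L s p.1 x) (L t p.2 y)).

(** The BMW algebra. The generators T_i and E_i, 1 <= i <= r - 1, are
    indexed by ['I_r.-1] starting from 0. The inverse of T_i is the element
    [bmw_inv] prescribed by T_i - T_i^-1 = (q - q^-1)(1 - E_i). *)

Variant BMWgen (r : nat) := GenT of 'I_r.-1 | GenBE of 'I_r.-1.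

Definition bmw_inv (kappa : fieldType) (q : kappa) (B : pzAlgType kappa)
    (Ti Ei : B) : B :=
  Ti - (q - q^-1) **: (1 - Ei).

Definition neighbours (m : nat) (i j : 'I_m) : bool :=
  (i.+1 == j :> nat) || (j.+1 == i :> nat).

Record BMW_rel (kappa : fieldType) (rh q : kappa) (m : nat)
    (B : pzAlgType kappa) (T E : 'I_m -> B) : Prop := {
  BMW_TTV : forall i, T i * bmw_inv q (T i) (E i) = 1;
  BMW_TVT : forall i, bmw_inv q (T i) (E i) * T i = 1;
  BMW_cubic : forall i, (T i - cst q) * (T i + cst q^-1) * (T i - cst rh^-1) = 0;
  BMW_braid : forall i j : 'I_m, j = i.+1 :> nat ->
    T i * T j * T i = T j * T i * T j;
  BMW_far : forall i j, i != j -> ~~ neighbours i j -> T i * T j = T j * T i;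
  BMW_ETE : forall i j, neighbours i j -> E i * T j * E i = rh **: E i;
  BMW_ETVE : forall i j, neighbours i j ->
    E i * bmw_inv q (T j) (E j) * E i = rh^-1 **: E i;
  BMW_ET : forall i, E i * T i = rh^-1 **: E i;
  BMW_TE : forall i, T i * E i = rh^-1 **: E i
}.

Definition BMW_sat (kappa : fieldType) (rh q : kappa) (r : nat)
    (B : pzAlgType kappa) (x : BMWgen r -> B) : Prop :=
  BMW_rel rh q (fun i => x (GenT i)) (fun i => x (GenBE i)).

Definition BMW (kappa : fieldType) (rh q : kappa) (r : nat) : pzAlgType kappa :=
  presented (@BMW_sat kappa rh q r).

Definition bmwT (kappa : fieldType) (rh q : kappa) (r : nat) (i : 'I_r.-1) :
  BMW rh q r := pgen (GenT i).
Definition bmwE (kappa : fieldType) (rh q : kappa) (r : nat) (i : 'I_r.-1) :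
  BMW rh q r := pgen (GenBE i).

Record BMW_flip (kappa : fieldType) (rh q : kappa) (r : nat)
    (sigma : BMW rh q r -> BMW rh q r) : Prop := {
  BMW_flip_antihom : alg_antihom sigma;
  BMW_flip_involutive : involutive sigma;
  BMW_flip_T : forall i, sigma (bmwT rh q i) = bmwT rh q (rev_ord i);
  BMW_flip_E : forall i, sigma (bmwE rh q i) = bmwE rh q (rev_ord i)
}.

(** The right action on [V^{(x) r}]. Elements of [V (x) V] are encoded as
    matrices, with [delta_mx k l] for v_k (x) v_l; basis vectors are indexed
    from 0, the involution [k |-> k'] being [rev_ord]. *)

Section RightAction.
Variables (kappa : fieldType) (n : nat) (q qh : kappa).
Let N := n.*2.+1.

(** Twice rho, which has half-integral entries. *)
Definition rho2 (i : 'I_N) : int :=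
  if (i < n)%N then 2 * (n%:Z - i%:Z) - 1
  else if i == n :> nat then 0
  else 2 * (n%:Z - i%:Z) + 1.

Definition mid : 'I_N := inord n.

Definition cap_tail (k : 'I_N) : 'M[kappa]_N :=
  \sum_(i : 'I_N | (k < i)%N) qh ^ (rho2 i - rho2 k) *: delta_mx (rev_ord i) i.

Definition Rcheck (k l : 'I_N) : 'M[kappa]_N :=
  let delta := q - q^-1 in
  if (k == mid) && (l == mid) then
    delta_mx mid mid
      - delta *: \sum_(i : 'I_N | (mid < i)%N) qh ^ rho2 i *: delta_mx (rev_ord i) i
  else if k == l then q *: delta_mx k k
  else if (l < k)%N then
    if k != rev_ord l then delta_mx l k
    else q^-1 *: delta_mx l k - delta *: cap_tail k
  else
    if k != rev_ord l then delta_mx l k + delta *: delta_mx k l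
    else q^-1 *: delta_mx l k + delta *: (delta_mx k l - cap_tail k).

Definition Emap (k l : 'I_N) : 'M[kappa]_N :=
  if k == rev_ord l then
    \sum_i qh ^ (rho2 (rev_ord i) - rho2 k) *: delta_mx i (rev_ord i)
  else 0.

Definition fstpos (r : nat) (i : 'I_r.-1) : 'I_r := widen_ord (leq_pred r) i.

Fact sndpos_proof (r : nat) (i : 'I_r.-1) : (i.+1 < r)%N.
Proof. by case: r i => [[]|r i] //=; rewrite ltnS ltn_ord. Qed.
Definition sndpos (r : nat) (i : 'I_r.-1) : 'I_r := Ordinal (sndpos_proof i).

Definition on_factors (M : 'I_N -> 'I_N -> 'M[kappa]_N) (r : nat) (i : 'I_r.-1)
    (x : tpow kappa n r) : tpow kappa n r :=
  \sum_(k : {ffun 'I_r -> 'I_N}) x k *: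
    (\sum_(a : 'I_N) \sum_(b : 'I_N) M (k (fstpos i)) (k (sndpos i)) a b *:
      tbasis kappa [ffun j : 'I_r =>
        if j == fstpos i then a else if j == sndpos i then b else k j]).

Record BMW_action (rh : kappa) (r : nat)
    (R : tpow kappa n r -> BMW rh q r -> tpow kappa n r) : Prop := {
  BMW_action_module : right_module R;
  BMW_action_T : forall i x, R x (bmwT rh q i) = on_factors Rcheck i x;
  BMW_action_E : forall i x, R x (bmwE rh q i) = on_factors Emap i x
}.

End RightAction.

Definition dual (kappa : fieldType) (M : vectType kappa) : vectType kappa :=
  'Hom(M, kappa^o).

Definition dual_left (kappa : fieldType) (M : vectType kappa) (A : pzAlgType kappa)
    (S : A -> A) (L : A -> M -> M) (u : A) (phi : dual M) : dual M :=
  linfun (fun x => phi (L (S u) x)).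

Definition dual_right (kappa : fieldType) (M : vectType kappa) (A : pzAlgType kappa)
    (sigma : A -> A) (R : M -> A -> M) (phi : dual M) (b : A) : dual M :=
  linfun (fun x => phi (R x (sigma b))).

Definition bimodule_iso (kappa : fieldType) (A B : pzAlgType kappa)
    (M1 M2 : lmodType kappa) (L1 : A -> M1 -> M1) (R1 : M1 -> B -> M1)
    (L2 : A -> M2 -> M2) (R2 : M2 -> B -> M2) : Prop :=
  exists2 theta : {linear M1 -> M2}, bijective theta &
    (forall a x, theta (L1 a x) = L2 a (theta x)) /\
    (forall x b, theta (R1 x b) = R2 (theta x) b).

(* Main.v *)
Require Import Defs.
From HB Require Import structures.
From mathcomp Require Import all_boot all_order all_algebra.
From mathcomp Require Import generic_quotient boolp.
From mathcomp Require Import zify ring.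

Set Implicit Arguments.
Unset Strict Implicit.
Unset Printing Implicit Defensive.

Import Order.TTheory GRing.Theory Num.Theory.
Local Open Scope ring_scope.

(* Let c_k = q^(- rho_k) and let <v_k, v_l> = c_k if l = k' and 0 otherwise. On
   [V^(x)r] take the form pairing the i-th factor on the left with the
   (r+1-i)-th factor on the right. Reversing the factors turns the coproduct
   into [Delta o S = (S (x) S) o Delta^op], so that invariance
   <u x, y> = <x, S(u) y> passes from [V] to [V^(x)r], and it exchanges T_i with
   T_(r-i). The form on [V (x) V] is compatible with R and E because
   their matrices satisfy M_(kl)^(ab) c_a c_b = M_(b'a')^(l'k') c_k c_l.
   As some quantum integers may vanish in kappa, invariance has to be checked on
   all divided powers; their coproducts come from the q-binomial theorem. *)

(** * Algebras and presentations *)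

(** The c_k are forced up to a common scalar. Invariance under e_i, with S(e_i) = -k_i^-1 e_i, reads
    <e_i x, y> = -<k_i x, e_i y>; on basis vectors this fixes the ratio c_(k+1) / c_k, which is q
    except for q^(1/2) at the two steps next to v_(n+1). The chosen normalisation gives c_k c_(k') =
    1. Because S and the flip of the BMW algebra reverse products, the elements with the adjunction
    property form a subalgebra, so generators suffice on both sides. The obstacle is that the
    coproduct and the antipode over kappa are known only through generic ones evaluated on the
    integral form. Every identity to be specialised is therefore proved over Q(v), where quantum
    integers are invertible, with explicit integral elements and signed powers of v as
    coefficients. *)

Section StructureMap.
Variables (K : fieldType) (A : pzAlgType K).
Implicit Types (a b : K) (x y : A).

Lemma cstB a b : cst (a - b) = cst a - cst b :> A.
Proof. exact: cst_zmod_morphism. Qed.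

Lemma cstN a : cst (- a) = - cst a :> A.
Proof. by rewrite -sub0r cstB cst0 sub0r. Qed.

Lemma cstD a b : cst (a + b) = cst a + cst b :> A.
Proof. by rewrite -[b in LHS]opprK cstB cstN opprK. Qed.

Lemma cstM a b : cst (a * b) = cst a * cst b :> A.
Proof. by have [_ ->] := cst_monoid_morphism (s := A). Qed.

Lemma cst_mull a x y : (a **: x) * y = a **: (x * y).
Proof. by rewrite mulrA. Qed.

Lemma cst_mulr a x y : x * (a **: y) = a **: (x * y).
Proof. by rewrite mulrA -cst_central mulrA. Qed.

Lemma cst_mulA a b x : a **: (b **: x) = (a * b) **: x.
Proof. by rewrite cstM mulrA. Qed.

Lemma cst_mulM a b x y : (a **: x) * (b **: y) = (a * b) **: (x * y).
Proof. by rewrite cst_mull cst_mulr cst_mulA. Qed.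

Lemma cst_mulX a x m : (a **: x) ^+ m = a ^+ m **: x ^+ m.
Proof.
elim: m => [|m IH]; first by rewrite !expr0 cst1 mul1r.
by rewrite !exprS IH cst_mulM.
Qed.

Lemma commute_powr a x y m : x * y = a **: (y * x) ->
  x * y ^+ m = a ^+ m **: (y ^+ m * x).
Proof.
move=> h; elim: m => [|m IH]; first by rewrite !expr0 mulr1 cst1 !mul1r.
rewrite exprSr mulrA IH cst_mull -mulrA h cst_mulr cst_mulA -mulrA.
by rewrite exprSr !mulrA.
Qed.

End StructureMap.

Section Homomorphisms.
Variables (K : fieldType) (A B : pzAlgType K).

Section Hom.
Variables (f : A -> B) (hf : alg_hom f).

Lemma alg_hom1 : f 1 = 1.
Proof. by case: hf => h _ _; rewrite -(cst1 A) h cst1. Qed.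

Lemma alg_homZ a x : f (a **: x) = a **: f x.
Proof. by case: hf => h _ ->; rewrite h. Qed.

Lemma alg_homN x : f (- x) = - f x.
Proof. by rewrite -mulN1r -cstN1 alg_homZ cstN1 mulN1r. Qed.

Lemma alg_homX x m : f (x ^+ m) = f x ^+ m.
Proof.
case: hf => _ _ hM.
by elim: m => [|m IH]; rewrite ?alg_hom1 // !exprS hM IH.
Qed.

End Hom.

Section AntiHom.
Variables (f : A -> B) (hf : alg_antihom f).

Lemma alg_antihom1 : f 1 = 1.
Proof. by case: hf => h _ _; rewrite -(cst1 A) h cst1. Qed.

Lemma alg_antihomZ a x : f (a **: x) = a **: f x.
Proof. by case: hf => h _ ->; rewrite h cst_central. Qed.

Lemma alg_antihomN x : f (- x) = - f x.
Proof. by rewrite -mulN1r -cstN1 alg_antihomZ cstN1 mulN1r. Qed.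

Lemma alg_antihomX x m : f (x ^+ m) = f x ^+ m.
Proof.
case: hf => _ _ hM.
by elim: m => [|m IH]; rewrite ?alg_antihom1 // exprS exprSr hM IH.
Qed.

End AntiHom.
End Homomorphisms.

Section PresentedAlgebra.
Local Open Scope quotient_scope.
Variables (K : fieldType) (X : Type).
Variable sat : forall B : pzAlgType K, (X -> B) -> Prop.
Arguments sat {B}.

Local Notation P := (presented (@sat)).

Definition induced (B : pzAlgType K) (x : X -> B) (u : P) : B := eval x (repr u).

Section Induced.
Variables (B : pzAlgType K) (x : X -> B) (hx : sat x).

Lemma induced_gen i : induced x (pgen i) = x i.
Proof. by rewrite /induced (eval_repr _ hx). Qed.

Lemma inducedD u w : induced x (u + w) = induced x u + induced x w.
Proof. by rewrite /induced (eval_repr (TAdd _ _) hx). Qed.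

Lemma inducedM u w : induced x (u * w) = induced x u * induced x w.
Proof. by rewrite /induced (eval_repr (TMul _ _) hx). Qed.

Lemma induced_cst a : induced x (cst a) = cst a.
Proof. by rewrite /induced (eval_repr (TConst X a) hx). Qed.

Lemma induced_hom : alg_hom (induced x).
Proof. by split; [apply: induced_cst | apply: inducedD | apply: inducedM]. Qed.

Lemma induced1 : induced x 1 = 1.
Proof. exact: alg_hom1 induced_hom. Qed.

End Induced.

(** Identities in a presented algebra are tested in every model of the relations. There a relation
    is simply a hypothesis, so the generated congruence is never handled directly. *)
Lemma induced_ext (u w : P) :
  (forall (B : pzAlgType K) (x : X -> B), sat x -> induced x u = induced x w) -> u = w.
Proof. exact: presented_ext. Qed.

(** Each class is represented by a term, so this is induction on terms, once the class of a formal
    sum or product is known to be the sum or product of the classes. *)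
Lemma presented_ind (Q : P -> Prop) :
    (forall a, Q (cst a)) -> (forall i, Q (pgen i)) ->
    (forall u w, Q u -> Q w -> Q (u + w)) ->
    (forall u w, Q u -> Q w -> Q (u * w)) ->
  forall u, Q u.
Proof.
move=> Qc Qg QD QM u; rewrite -[u](reprK u).
elim: (repr u) => [i|a|t1 h1 t2 h2|t1 h1 t2 h2].
- exact: Qg.
- exact: Qc.
- suff -> : \pi_P (TAdd t1 t2) = \pi_P t1 + \pi_P t2 :> P by apply: QD.
  by apply: induced_ext => B x hx; rewrite inducedD // /induced !(eval_repr _ hx).
- suff -> : \pi_P (TMul t1 t2) = \pi_P t1 * \pi_P t2 :> P by apply: QM.
  by apply: induced_ext => B x hx; rewrite inducedM // /induced !(eval_repr _ hx).
Qed.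

End PresentedAlgebra.

Section Tensor.
Variables (K : fieldType) (A1 A2 : pzAlgType K).

(** For an arbitrary predicate [sat] the generators of the presented algebra need not satisfy [sat];
    here they do, because each clause is an identity that can be tested in models. *)
Lemma tensor_pgen :
  tensor_rel (fun s : A1 + A2 => pgen s : tensor_alg A1 A2).
Proof.
split=> [||a1 a2].
- split=> [a|x y|x y]; apply: induced_ext => B x0 hx; case: (hx) => -[h1 h2 h3] _ _.
  + by rewrite induced_gen // induced_cst // h1.
  + by rewrite inducedD // !induced_gen.
  + by rewrite inducedM // !induced_gen.
- split=> [a|x y|x y]; apply: induced_ext => B x0 hx; case: (hx) => _ -[h1 h2 h3] _.
  + by rewrite induced_gen // induced_cst // h1.
  + by rewrite inducedD // !induced_gen.
  + by rewrite inducedM // !induced_gen.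
- apply: induced_ext => B x0 hx; case: (hx) => _ _ h.
  by rewrite !inducedM // !induced_gen // h.
Qed.

Lemma tensorM (a b : A1) (c d : A2) :
  tensor a c * tensor b d = tensor (a * b) (c * d) :> tensor_alg A1 A2.
Proof.
case: tensor_pgen => -[_ _ h1] [_ _ h2] h.
by rewrite /tensor h1 h2 -!mulrA (mulrA (pgen (inr c))) -h -!mulrA.
Qed.

Lemma tensor1 : tensor 1 1 = 1 :> tensor_alg A1 A2.
Proof.
case: tensor_pgen => h1 h2 _.
by rewrite /tensor (alg_hom1 h1) (alg_hom1 h2) mulr1.
Qed.

Lemma tensorZl a (x : A1) (y : A2) :
  tensor (a **: x) y = a **: tensor x y :> tensor_alg A1 A2.
Proof. by case: tensor_pgen => h1 _ _; rewrite /tensor (alg_homZ h1) cst_mull. Qed.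

Lemma tensorZr a (x : A1) (y : A2) :
  tensor x (a **: y) = a **: tensor x y :> tensor_alg A1 A2.
Proof. by case: tensor_pgen => _ h2 _; rewrite /tensor (alg_homZ h2) cst_mulr. Qed.

Lemma tensorNl (x : A1) (y : A2) :
  tensor (- x) y = - tensor x y :> tensor_alg A1 A2.
Proof. by case: tensor_pgen => h1 _ _; rewrite /tensor (alg_homN h1) mulNr. Qed.

Lemma tensorNr (x : A1) (y : A2) :
  tensor x (- y) = - tensor x y :> tensor_alg A1 A2.
Proof. by case: tensor_pgen => _ h2 _; rewrite /tensor (alg_homN h2) mulrN. Qed.

Lemma tensorX (x : A1) (y : A2) m :
  tensor x y ^+ m = tensor (x ^+ m) (y ^+ m) :> tensor_alg A1 A2.
Proof.
elim: m => [|m IH]; first by rewrite !expr0 tensor1.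
by rewrite !exprS IH tensorM.
Qed.

End Tensor.

(** * The q-binomial theorem for divided powers *)

Lemma vq_unit : vq != 0.
Proof. by rewrite /vq tofrac_eq0 polyX_eq0. Qed.

Lemma vq_expr_neq1 m : (0 < m)%N -> vq ^+ m != 1.
Proof.
move=> hm; rewrite /vq -tofracXn -tofrac1 tofrac_eq; apply/eqP => h.
have := congr1 (fun p : {poly rat} => size p) h.
by rewrite size_polyXn size_poly1; case: m hm {h}.
Qed.

Lemma vq_diff_neq0 m : (0 < m)%N -> vq ^+ m - vq ^- m != 0.
Proof.
move=> hm; have h0 : vq ^+ m != 0 by rewrite expf_neq0 ?vq_unit.
rewrite subr_eq0; apply: contra (vq_expr_neq1 (m := m + m) _) => [/eqP h|]; last lia.
by rewrite exprD {1}h mulVf.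
Qed.

Definition qint (d t : nat) : Qv := (vq ^+ (d * t) - vq ^- (d * t)) / (vq ^+ d - vq ^- d).

Lemma qfactS d m : qfact d m.+1 = qint d m.+1 * qfact d m.
Proof. by rewrite /qfact big_nat_recr //= mulrC. Qed.

Lemma qfact0 d : qfact d 0 = 1.
Proof. by rewrite /qfact big_nil. Qed.

Lemma qint_neq0 d t : (0 < d)%N -> (0 < t)%N -> qint d t != 0.
Proof.
move=> hd ht; rewrite mulf_neq0 ?invr_neq0 ?vq_diff_neq0 //.
by rewrite muln_gt0 hd.
Qed.

(** The mixed terms x/y cancel. With x = v^(da) and y = v^(db) this is the addition law of quantum
    integers, in the one of its two forms that fits the powers of v in the binomial theorem. *)
Lemma sub_inv_mulD (F : fieldType) (x y w : F) : x != 0 -> y != 0 ->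
  (x * y - (x * y)^-1) / w = y^-1 * ((x - x^-1) / w) + x * ((y - y^-1) / w).
Proof.
move=> hx hy; rewrite invfM !mulrA -mulrDl; congr (_ / _).
by field; rewrite hx hy.
Qed.

Lemma qintD d a b :
  qint d (a + b) = vq ^- (d * b) * qint d a + vq ^+ (d * a) * qint d b.
Proof. by rewrite /qint mulnDr exprD sub_inv_mulD ?expf_neq0 ?vq_unit. Qed.

Section Binomial.
Variables (A : pzAlgType Qv) (d : nat) (hd : (0 < d)%N).

Definition divpow (x : A) m : A := (qfact d m)^-1 **: x ^+ m.

Lemma divpow0 x : divpow x 0 = 1.
Proof. by rewrite /divpow qfact0 invr1 cst1 mul1r expr0. Qed.

Lemma mul_divpow x m : x * divpow x m = qint d m.+1 **: divpow x m.+1.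
Proof.
rewrite /divpow cst_mulr -exprS cst_mulA qfactS invfM mulrA mulfV ?mul1r //.
exact: qint_neq0.
Qed.

Lemma commute_divpow a x y m : x * y = a **: (y * x) ->
  x * divpow y m = a ^+ m **: (divpow y m * x).
Proof.
by move=> h; rewrite /divpow cst_mulr (commute_powr _ h) cst_mull !cst_mulA mulrC.
Qed.

(** Passing to divided powers absorbs the q-binomial coefficients, so that only powers of v remain.
    This makes the coproducts of divided powers visibly integral. *)
Lemma divpow_binomial (x y : A) m : y * x = vq ^+ (2 * d) **: (x * y) ->
  divpow (x + y) m = \sum_(j < m.+1)
    vq ^+ (d * j * (m - j)) **: (divpow x (m - j) * divpow y j).
Proof.
move=> hyx; elim: m => [|m IH].
  by rewrite big_ord_recl big_ord0 /= muln0 expr0 cst1 !divpow0 !mulr1 addr0.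
have q0 := qint_neq0 hd (ltn0Sn m).
(* Multiplication by [m+1], invertible over Q(v), turns the left side into (x + y) times the m-th
   divided power, to which the induction hypothesis applies. *)
suff h : qint d m.+1 **: divpow (x + y) m.+1 = qint d m.+1 **:
    \sum_(j < m.+2) vq ^+ (d * j * (m.+1 - j)) **: (divpow x (m.+1 - j) * divpow y j).
  have := congr1 (fun z => (qint d m.+1)^-1 **: z) h.
  by rewrite !cst_mulA mulVf // cst1 !mul1r.
rewrite -mul_divpow IH mulrDl !mulr_sumr.
(* By induction and [y x^a = v^(2da) x^a y], the coefficient of x^(m+1-j) y^j
   receives one term from x and one from y; they add up by [qintD]. *)
pose u j := (vq ^+ (d * j * (m - j)) * qint d (m.+1 - j)) **:
  (divpow x (m.+1 - j) * divpow y j).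
pose w j := (vq ^+ (2 * d * (m.+1 - j) + d * j.-1 * (m.+1 - j)) * qint d j) **:
  (divpow x (m.+1 - j) * divpow y j).
(* Since [0] = 0, [u] vanishes at m+1 and [w] at 0. Both sums thus extend to the same range, and the
   truncated values of [m - j] and [j.-1] at these ends do no harm. *)
have qint0 : qint d 0 = 0 by rewrite /qint muln0 expr0 invr1 subrr mul0r.
have um : u m.+1 = 0 by rewrite /u subnn qint0 mulr0 cst0 mul0r.
have w0 : w 0%N = 0 by rewrite /w qint0 mulr0 cst0 mul0r.
have -> : \sum_(i < m.+1)
    x * (vq ^+ (d * i * (m - i)) **: (divpow x (m - i) * divpow y i)) =
    \sum_(i < m.+2) u i.
  rewrite [RHS]big_ord_recr /= um addr0; apply: eq_bigr => i _.
  rewrite cst_mulr (mulrA x) mul_divpow cst_mull cst_mulA /u subSn //.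
  by rewrite -ltnS.
have -> : \sum_(i < m.+1)
    y * (vq ^+ (d * i * (m - i)) **: (divpow x (m - i) * divpow y i)) =
    \sum_(i < m.+2) w i.
  rewrite [RHS]big_ord_recl w0 add0r; apply: eq_bigr => i _.
  rewrite cst_mulr (mulrA y) (commute_divpow _ hyx) cst_mull -mulrA mul_divpow.
  rewrite (cst_mulr _ (divpow x _)) !cst_mulA /w lift0 subSS [_.-1]/=; congr (cst _ * _).
  by rewrite -exprM -exprD addnC.
rewrite -big_split; apply: eq_bigr => j _ /=.
rewrite /u /w -mulrDl -cstD cst_mulA; congr (cst _ * _).
have hj : (j <= m.+1)%N by rewrite -ltnS.
have -> : qint d m.+1 = qint d (m.+1 - j + j) by rewrite subnK.
rewrite qintD mulrDl ![_ * qint _ _ * _]mulrAC; congr (_ + _).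
- have [hm|hm] := leqP j m; last first.
    by rewrite (_ : m.+1 - j = 0)%N ?qint0 ?mulr0 //; lia.
  congr (_ * _); apply: (mulfI (expf_neq0 (d * j) vq_unit)).
  rewrite mulrA mulfV ?expf_neq0 ?vq_unit // mul1r -exprD; congr (_ ^+ _).
  by rewrite subSn // mulnS addnC.
- case: (nat_of_ord j) hj => [|i] hi; first by rewrite qint0 !mulr0.
  rewrite -exprD; congr (_ ^+ _ * _) => /=; rewrite subSS.
  by move: (m - i)%N => t; ring.
Qed.

End Binomial.

Section DividedPowers.
Variable d : nat.

Lemma alg_hom_divpow (A B : pzAlgType Qv) (f : A -> B) x m :
  alg_hom f -> f (divpow d x m) = divpow d (f x) m.
Proof. by move=> hf; rewrite /divpow (alg_homZ hf) (alg_homX hf). Qed.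

Lemma alg_antihom_divpow (A B : pzAlgType Qv) (f : A -> B) x m :
  alg_antihom f -> f (divpow d x m) = divpow d (f x) m.
Proof. by move=> hf; rewrite /divpow (alg_antihomZ hf) (alg_antihomX hf). Qed.

Lemma divpow_tensorl (A : pzAlgType Qv) (x y : A) m :
  divpow d (tensor x y) m = tensor (divpow d x m) (y ^+ m) :> tensor_alg A A.
Proof. by rewrite /divpow tensorX tensorZl. Qed.

Lemma divpow_tensorr (A : pzAlgType Qv) (x y : A) m :
  divpow d (tensor x y) m = tensor (x ^+ m) (divpow d y m) :> tensor_alg A A.
Proof. by rewrite /divpow tensorX tensorZr. Qed.

(** Collecting the x to the left takes m(m-1)/2 exchanges, each contributing b^2; taking the
    commutation factor as a square avoids halving the exponent. *)
Lemma divpowMZ (A : pzAlgType Qv) (x y : A) (b : Qv) m :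
  y * x = b ^+ 2 **: (x * y) ->
  divpow d (x * y) m = b ^+ (m * m.-1) **: (x ^+ m * divpow d y m).
Proof.
move=> h; suff hX : (x * y) ^+ m = b ^+ (m * m.-1) **: (x ^+ m * y ^+ m).
  by rewrite /divpow hX (cst_mulr _ (x ^+ m)) !cst_mulA mulrC.
elim: m => [|m IH]; first by rewrite !expr0 cst1 !mulr1.
rewrite exprS IH cst_mulr -mulrA (mulrA y) (commute_powr _ h) cst_mull cst_mulr.
rewrite cst_mulA -exprM -exprD; congr (cst (_ ^+ _) * _).
  by case: m {IH} => //= m; ring.
by rewrite !exprS !mulrA.
Qed.

Lemma divpow_mulr (A : pzAlgType Qv) (x y : A) m :
  x ^+ m * divpow d y m = divpow d x m * y ^+ m.
Proof. by rewrite /divpow cst_mulr cst_mull. Qed.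

Lemma divpowN (A : pzAlgType Qv) (x : A) m :
  divpow d (- x) m = (-1) ^+ m **: divpow d x m.
Proof.
rewrite /divpow -(mulN1r x) -(cstN1 A) cst_mulX.
by rewrite !cst_mulA mulrC.
Qed.

End DividedPowers.

(** * Coproduct and antipode on divided powers *)

Section QuantumGroup.
Variable n : nat.
Implicit Types i j : 'I_n.
Local Notation U := (Uv n).

(** The integer division cancels as soon as the root has positive norm, so long and short roots need
    not be distinguished. *)
Lemma cartan_diag i : cartan i i = 2.
Proof.
rewrite /cartan mulzK // gt_eqF // /root_form (bigD1 i) //= ltr_pwDl ?sumr_ge0 //.
  rewrite /simple_root eqxx (_ : (i == i.+1 :> nat) = false) //.
  by apply/eqP => h; lia.
by move=> j _; rewrite -expr2 sqr_ge0.
Qed.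

Lemma dsym_gt0 i : (0 < dsym i)%N.
Proof. by rewrite /dsym; case: ifP. Qed.

Lemma kU_kVU i : kU i * kVU i = 1.
Proof.
apply: induced_ext => B x hx.
by rewrite inducedM // induced1 // !induced_gen // (U_relKV hx).
Qed.

Lemma kVU_kU i : kVU i * kU i = 1.
Proof.
apply: induced_ext => B x hx.
by rewrite inducedM // induced1 // !induced_gen // -(U_relKKV hx) (U_relKV hx).
Qed.

Lemma kU_eU i : kU i * eU i = (vq ^+ dsym i) ^+ 2 **: (eU i * kU i).
Proof.
have h : kU i * eU i * kVU i = (vq ^+ dsym i) ^+ 2 **: eU i.
  apply: induced_ext => B x hx.
  rewrite !inducedM // induced_cst // !induced_gen // (U_relKE hx) cartan_diag.
  by rewrite -exprM.
by rewrite mulrA -h -mulrA kVU_kU mulr1.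
Qed.

Lemma kU_fU i : kU i * fU i = (vq ^- dsym i) ^+ 2 **: (fU i * kU i).
Proof.
have h : kU i * fU i * kVU i = (vq ^- dsym i) ^+ 2 **: fU i.
  apply: induced_ext => B x hx.
  rewrite !inducedM // induced_cst // !induced_gen // (U_relKF hx) cartan_diag.
  by rewrite exprVn -exprM -exprnN.
by rewrite mulrA -h -mulrA kVU_kU mulr1.
Qed.

Lemma eU_kVU i : eU i * kVU i = (vq ^+ dsym i) ^+ 2 **: (kVU i * eU i).
Proof.
rewrite -[eU i in LHS]mul1r -(kVU_kU i) -!mulrA (mulrA (kU i)) kU_eU.
by rewrite -!mulrA cst_mulr kU_kVU mulr1.
Qed.

Lemma kVU_fU i : kVU i * fU i = (vq ^+ dsym i) ^+ 2 **: (fU i * kVU i).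
Proof.
have h0 : (vq ^+ dsym i) ^+ 2 != 0 by rewrite !expf_neq0 ?vq_unit.
have h : fU i * kU i = (vq ^+ dsym i) ^+ 2 **: (kU i * fU i).
  by rewrite kU_fU cst_mulA exprVn mulfV // cst1 mul1r.
rewrite -[fU i in LHS]mulr1 -(kU_kVU i) (mulrA (fU i)) h.
rewrite cst_mull cst_mulr; congr (_ * _).
by rewrite !mulrA kVU_kU mul1r.
Qed.

Lemma vqD_sqr (i : 'I_n) : vq ^+ (2 * dsym i) = (vq ^+ dsym i) ^+ 2.
Proof. by rewrite mulnC exprM. Qed.

Lemma integralX (u : U) m : integral u -> integral (u ^+ m).
Proof.
move=> hu; elim: m => [|m IH]; first by rewrite expr0; apply: Defs.integral1.
by rewrite exprS; apply: Defs.integralM.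
Qed.

(** The antipodes of divided powers carry signed monomials in v. Naming these by a polynomial and an
    exponent lets [base_change_relZ] evaluate the same coefficient at [qh]. *)
Lemma laurent_monomial (E : fieldType) (x : E) (c a b : nat) :
  laurent x ((-1) ^+ c *: 'X^a) b = (-1) ^+ c * x ^+ a / x ^+ b.
Proof. by rewrite /laurent map_polyZ map_polyXn hornerZ hornerXn rmorphXn rmorphN1. Qed.

Lemma integral_vqX a (u : U) : integral u -> integral (vq ^+ a **: u).
Proof.
move=> hu; have := Defs.integralZ ((-1) ^+ 0 *: 'X^a) 0 hu.
by rewrite laurent_monomial expr0 mul1r divr1.
Qed.

Section Antipode.
Variables (S : U -> U) (hS : generic_antipode S).
Let hA := generic_antipode_antihom hS.

(** [generic_antipode] prescribes S at k only; S(k^-1) is determined as the inverse of S(k). *)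
Lemma antipode_kVU i : S (kVU i) = kU i.
Proof.
case: (hA) => _ _ hM.
rewrite -[LHS]mulr1 -(kVU_kU i) -{2}(generic_antipode_k hS) mulrA -hM kU_kVU.
by rewrite (alg_antihom1 hA) mul1r.
Qed.

Lemma antipode_e_divpow i m :
  S (e_divpow i m) = laurent vq ((-1) ^+ m *: 'X^(dsym i * (m * m.-1))) 0
    **: (kVU i ^+ m * e_divpow i m).
Proof.
rewrite [LHS](alg_antihom_divpow _ _ _ hA) (generic_antipode_e hS) divpowN.
by rewrite (divpowMZ _ _ (eU_kVU i)) cst_mulA laurent_monomial expr0 divr1 -exprM.
Qed.

Lemma antipode_f_divpow i m :
  S (f_divpow i m) = laurent vq ((-1) ^+ m *: 'X^0) (dsym i * (m * m.-1))
    **: (f_divpow i m * kU i ^+ m).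
Proof.
rewrite [LHS](alg_antihom_divpow _ _ _ hA) (generic_antipode_f hS) divpowN.
(* [divpowMZ] leaves the quantum factorial under the power of k; [divpow_mulr] moves it back under
   the power of f. *)
rewrite (divpowMZ _ _ (kU_fU i)) divpow_mulr cst_mulA laurent_monomial.
by rewrite mulr1 exprVn -exprM.
Qed.

(** The antipode over kappa is prescribed at u only when S(u) is itself the value of an integral
    element; this makes the prescription cover every u. *)
Lemma antipode_integral u : integral u -> integral (S u).
Proof.
case: (hA) => hc hD hM; elim=> {u} [|u w _ hu _ hw|u w _ hu _ hw|p m u _ hu|i m|i m|i|i].
- rewrite (alg_antihom1 hA); exact: Defs.integral1.
- by rewrite hD (alg_antihomN hA); apply: Defs.integralB.
- by rewrite hM; apply: Defs.integralM.
- by rewrite (alg_antihomZ hA); apply: Defs.integralZ.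
- rewrite antipode_e_divpow; apply/Defs.integralZ/Defs.integralM; last exact: integral_e.
  exact/integralX/integral_kV.
- rewrite antipode_f_divpow; apply/Defs.integralZ/Defs.integralM; first exact: integral_f.
  exact/integralX/integral_k.
- rewrite (generic_antipode_k hS); exact: integral_kV.
- rewrite antipode_kVU; exact: integral_k.
Qed.

End Antipode.
End QuantumGroup.

Section Coproduct.
Variable n : nat.
Local Notation U := (Uv n).
Variables (D : U -> tensor_alg U U) (hD : generic_coproduct D).
Variables (S : U -> U) (hS : generic_antipode S).
Let hDh := generic_coproduct_hom hD.
Let hSa := generic_antipode_antihom hS.

(* [Delta (S u) = (S (x) S) (Delta^op u)], witnessed by tensors of elements of the
   integral form, since only these determine the coproduct of [Uk]. *)
Definition coproduct_flip (u : U) : Prop :=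
  exists2 s : seq (Uint n * Uint n),
    D u = \sum_(p <- s) tensor (val p.1) (val p.2) &
    D (S u) = \sum_(p <- s) tensor (S (val p.2)) (S (val p.1)).

Lemma coproduct_flip_sum (I : finType) (u : U) (a b : I -> U) :
    (forall j, integral (a j)) -> (forall j, integral (b j)) ->
    D u = \sum_j tensor (a j) (b j) ->
    D (S u) = \sum_j tensor (S (b j)) (S (a j)) ->
  coproduct_flip u.
Proof.
move=> ha hb h1 h2.
exists [seq (UintSub (introT (asboolP _) (ha j)), UintSub (introT (asboolP _) (hb j)))
  | j <- index_enum I].
- by rewrite h1 big_map.
- by rewrite h2 big_map.
Qed.

(** The two sides are a left and a right inverse of the coproduct of k. *)
Lemma coproduct_kVU i : D (kVU i) = tensor (kVU i) (kVU i).
Proof.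
case: (hDh) => _ _ hM.
have h : D (kVU i) * D (kU i) = 1 by rewrite -hM kVU_kU (alg_hom1 hDh).
have h' : D (kU i) * tensor (kVU i) (kVU i) = 1.
  by rewrite (generic_coproduct_k hD) tensorM kU_kVU tensor1.
by rewrite -[LHS]mulr1 -h' mulrA h mul1r.
Qed.

Lemma coproduct_flip_kU i : coproduct_flip (kU i).
Proof.
apply: (@coproduct_flip_sum 'I_1 _ (fun=> kU i) (fun=> kU i)) => *.
- exact: integral_k.
- exact: integral_k.
- by rewrite big_ord_recl big_ord0 addr0 (generic_coproduct_k hD).
- by rewrite big_ord_recl big_ord0 addr0 (generic_antipode_k hS) coproduct_kVU.
Qed.

(** Delta(e) = e (x) 1 + k (x) e and Delta(S e) = S e (x) k^-1 + 1 (x) S e both have summands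
    commuting up to v^(2d). The binomial theorem expands the m-th divided power of each, and the
    expansions match term by term under j -> m - j. *)
Lemma coproduct_flip_e_divpow i m : coproduct_flip (e_divpow i m).
Proof.
case: (hDh) => _ hDD hDM; case: (hSa) => _ _ hSM.
pose d := dsym i; pose e := eU i; pose k := kU i; pose kV := kVU i.
have Sk : S k = kV by rewrite (generic_antipode_k hS).
have Se : S e = - (kV * e) by rewrite (generic_antipode_e hS).
have kVSe : S e * kV = vq ^+ (2 * d) **: (kV * S e).
  by rewrite Se mulNr -mulrA eU_kVU cst_mulr !mulrN vqD_sqr.
have ke : k * e = vq ^+ (2 * d) **: (e * k) by rewrite vqD_sqr; exact: kU_eU.
have DSe : D (S e) = tensor (S e) kV + tensor 1 (S e).
  rewrite Se (alg_homN hDh) hDM coproduct_kVU (generic_coproduct_e hD) mulrDr.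
  by rewrite !tensorM kVU_kU mulr1 tensorNl tensorNr opprD.
(* The witnesses have to be pure tensors of integral elements, so the power of v is absorbed into
   the left factor. *)
pose a (j : 'I_m.+1) := vq ^+ (d * j * (m - j)) **: (divpow d e (m - j) * k ^+ j).
apply: (@coproduct_flip_sum _ _ a (fun j => divpow d e j)) => [j|j||].
- apply/integral_vqX/Defs.integralM; first exact: integral_e.
  exact/integralX/integral_k.
- exact: integral_e.
- rewrite [LHS](alg_hom_divpow _ _ _ hDh) (generic_coproduct_e hD).
  rewrite (divpow_binomial (dsym_gt0 i)); last first.
    by rewrite !tensorM mulr1 mul1r -tensorZl -ke.
  apply: eq_bigr => j _; rewrite /a tensorZl divpow_tensorl divpow_tensorr.
  by rewrite tensorM expr1n mul1r.
- rewrite (alg_antihom_divpow _ _ _ hSa) (alg_hom_divpow _ _ _ hDh) DSe.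
  rewrite (divpow_binomial (dsym_gt0 i)); last first.
    by rewrite !tensorM mulr1 mul1r -tensorZr -kVSe.
  rewrite (reindex_inj rev_ord_inj) /=; apply: eq_bigr => j _.
  have hj : (j <= m)%N by rewrite -ltnS.
  rewrite subSS subKn // /a (alg_antihomZ hSa) tensorZr hSM (alg_antihomX hSa) Sk.
  rewrite !(alg_antihom_divpow _ _ _ hSa) divpow_tensorl divpow_tensorr tensorM.
  by rewrite expr1n mulr1 mulnAC.
Qed.

Lemma coproduct_flip_f_divpow i m : coproduct_flip (f_divpow i m).
Proof.
case: (hDh) => _ hDD hDM; case: (hSa) => _ _ hSM.
pose d := dsym i; pose f := fU i; pose k := kU i; pose kV := kVU i.
have SkV : S kV = k by apply: antipode_kVU.
have Sf : S f = - (f * k) by rewrite (generic_antipode_f hS).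
have kVf : kV * f = vq ^+ (2 * d) **: (f * kV) by rewrite vqD_sqr; exact: kVU_fU.
have Sfk : S f * k = vq ^+ (2 * d) **: (k * S f).
  by rewrite -SkV -!hSM kVf (alg_antihomZ hSa).
have DSf : D (S f) = tensor k (S f) + tensor (S f) 1.
  rewrite Sf (alg_homN hDh) hDM (generic_coproduct_k hD) (generic_coproduct_f hD).
  by rewrite mulrDl !tensorM kVU_kU mul1r tensorNl tensorNr opprD addrC.
pose b (j : 'I_m.+1) := vq ^+ (d * j * (m - j)) **: (divpow d f (m - j) * kV ^+ j).
apply: (@coproduct_flip_sum _ _ (fun j : 'I_m.+1 => divpow d f j) b) => [j|j||].
- exact: integral_f.
- apply/integral_vqX/Defs.integralM; first exact: integral_f.
  exact/integralX/integral_kV.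
(* As k^-1 f = v^(2d) f k^-1, the summand 1 (x) f has to come first for the binomial theorem to
   apply. *)
- rewrite [LHS](alg_hom_divpow _ _ _ hDh) (generic_coproduct_f hD) addrC.
  rewrite (divpow_binomial (dsym_gt0 i)); last first.
    by rewrite !tensorM mulr1 mul1r -tensorZr -kVf.
  apply: eq_bigr => j _; rewrite /b tensorZr divpow_tensorr divpow_tensorl.
  by rewrite tensorM expr1n mul1r.
- rewrite (alg_antihom_divpow _ _ _ hSa) (alg_hom_divpow _ _ _ hDh) DSf.
  rewrite (divpow_binomial (dsym_gt0 i)); last first.
    by rewrite !tensorM mulr1 mul1r -tensorZl -Sfk.
  rewrite (reindex_inj rev_ord_inj) /=; apply: eq_bigr => j _.
  have hj : (j <= m)%N by rewrite -ltnS.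
  rewrite subSS subKn // /b (alg_antihomZ hSa) tensorZl hSM (alg_antihomX hSa) SkV.
  rewrite !(alg_antihom_divpow _ _ _ hSa) divpow_tensorr divpow_tensorl tensorM.
  by rewrite expr1n mulr1 mulnAC.
Qed.

End Coproduct.

(** * Specialisation of the antipode and the coproduct to kappa *)

Definition kV_int (n : nat) (i : 'I_n) : Uint n :=
  UintSub (introT (asboolP _) (integral_kV i)).

Section BaseChange.
Variables (kappa : fieldType) (qh : kappa) (n : nat).
Local Notation bc := (@base_change kappa qh n).

Lemma base_change_sat : base_change_rel qh bc.
Proof.
split=> [u w|u w||p m u w h]; apply: induced_ext => B x hx.
- by rewrite inducedD // !induced_gen // (base_change_relD hx).
- by rewrite inducedM // !induced_gen // (base_change_relM hx).
- by rewrite induced1 // !induced_gen // (base_change_rel1 hx).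
- by rewrite inducedM // !induced_gen // induced_cst // (base_change_relZ hx h).
Qed.

Let bcD := base_change_relD base_change_sat.
Let bcM := base_change_relM base_change_sat.
Let bc1 := base_change_rel1 base_change_sat.

Lemma base_changeX u m : bc (u ^+ m) = bc u ^+ m.
Proof. by elim: m => [|m IH]; rewrite ?expr0 ?bc1 // !exprS bcM IH. Qed.

(** The sign is written as a constant so that, in [Uk_ind], closure under constants, sums and
    products covers differences of integral elements. *)
Lemma base_changeB u w : bc (u - w) = bc u + cst (-1) * bc w.
Proof.
rewrite cstN1 mulN1r; apply: (addIr (bc w)).
by rewrite -bcD !subrK.
Qed.

Lemma base_change_k_kV i : bc (k_int i) * bc (kV_int i) = 1.
Proof. by rewrite -bcM -bc1; congr (bc _); apply/val_inj/kU_kVU. Qed.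

Lemma base_change_kV_k i : bc (kV_int i) * bc (k_int i) = 1.
Proof. by rewrite -bcM -bc1; congr (bc _); apply/val_inj/kVU_kU. Qed.

(** Induction on the derivation of integrality reduces each generator of the presentation to divided
    powers and k^(+-1); Laurent coefficients become constants of kappa. *)
Lemma Uk_ind (Q : Uk qh n -> Prop) :
    (forall a, Q (cst a)) -> (forall u w, Q u -> Q w -> Q (u + w)) ->
    (forall u w, Q u -> Q w -> Q (u * w)) ->
    (forall i m, Q (bc (e_int i m))) -> (forall i m, Q (bc (f_int i m))) ->
    (forall i, Q (bc (k_int i))) -> (forall i, Q (bc (kV_int i))) ->
  forall u, Q u.
Proof.
move=> Qc QD QM Qe Qf Qk QkV; apply: presented_ind => // -[u hu].
have iu : integral u by apply/asboolP.
(* Displaying the membership proof allows the induction to generalise over it; two elements of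
   [Uint] with the same value are then identified by [val_inj]. *)
change (Q (bc (UintSub hu))).
elim: iu hu => {u} [|u w iu hu iw hw|u w iu hu iw hw|p m u iu hu|i m|i m|i|i] h.
- have -> : UintSub h = 1 by apply: val_inj.
  by have -> : bc 1 = cst 1 by [rewrite cst1; exact: bc1]; apply: Qc.
- move: (introT (asboolP _) iu) (introT (asboolP _) iw) => mu mw.
  have -> : UintSub h = UintSub mu - UintSub mw by apply: val_inj.
  by rewrite base_changeB; apply: QD => //; apply: QM.
- move: (introT (asboolP _) iu) (introT (asboolP _) iw) => mu mw.
  have -> : UintSub h = UintSub mu * UintSub mw by apply: val_inj.
  by rewrite bcM; apply: QM.
- move: (introT (asboolP _) iu) => mu.
  rewrite (@base_change_relZ _ _ _ _ _ base_change_sat p m (UintSub mu)) //.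
  exact: QM.
- by have -> : UintSub h = e_int i m by apply: val_inj.
- by have -> : UintSub h = f_int i m by apply: val_inj.
- by have -> : UintSub h = k_int i by apply: val_inj.
- by have -> : UintSub h = kV_int i by apply: val_inj.
Qed.

Section Antipode.
Variables (S : Uk qh n -> Uk qh n) (hS : is_antipode S).

Lemma antipode_base_change : exists2 Sv, @generic_antipode n Sv &
  forall u : Uint n, exists2 w : Uint n, val w = Sv (val u) &
    S (bc u) = bc w.
Proof.
case: hS => _ [Sv hSv h]; exists Sv => // u.
have hw : Sv (val u) \in @integral_pred n.
  by apply/asboolP/(antipode_integral hSv)/asboolP; case: (u).
by exists (UintSub hw); last exact: h.
Qed.

Lemma antipode_e_int i m : S (bc (e_int i m)) =
  ((-1) ^+ m * qh ^+ (dsym i * (m * m.-1))) **: (bc (kV_int i) ^+ m * bc (e_int i m)).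
Proof.
case: antipode_base_change => Sv hSv /(_ (e_int i m)) [w hw ->].
rewrite -base_changeX -bcM.
rewrite (base_change_relZ base_change_sat (p := (-1) ^+ m *: 'X^(dsym i * (m * m.-1)))
  (m := 0) (u := kV_int i ^+ m * e_int i m)).
  by rewrite laurent_monomial expr0 divr1.
rewrite hw (antipode_e_divpow hSv); congr (_ **: (_ * _)).
by elim: m {w hw} => // m IH; rewrite !exprS /= IH.
Qed.

Lemma antipode_f_int i m : S (bc (f_int i m)) =
  ((-1) ^+ m / qh ^+ (dsym i * (m * m.-1))) **: (bc (f_int i m) * bc (k_int i) ^+ m).
Proof.
case: antipode_base_change => Sv hSv /(_ (f_int i m)) [w hw ->].
rewrite -base_changeX -bcM.
rewrite (base_change_relZ base_change_sat (p := (-1) ^+ m *: 'X^0)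
  (m := dsym i * (m * m.-1)) (u := f_int i m * k_int i ^+ m)).
  by rewrite laurent_monomial expr0 mulr1.
rewrite hw (antipode_f_divpow hSv); congr (_ **: (_ * _)).
by elim: m {w hw} => // m IH; rewrite !exprS /= IH.
Qed.

Lemma antipode_k_int i : S (bc (k_int i)) = bc (kV_int i).
Proof.
case: antipode_base_change => Sv hSv /(_ (k_int i)) [w hw ->].
by congr (bc _); apply: val_inj; rewrite hw; exact: (generic_antipode_k hSv).
Qed.

Lemma antipode_kV_int i : S (bc (kV_int i)) = bc (k_int i).
Proof.
case: antipode_base_change => Sv hSv /(_ (kV_int i)) [w hw ->].
by congr (bc _); apply: val_inj; rewrite hw; exact: (antipode_kVU hSv).
Qed.

Variables (D : Uk qh n -> tensor_alg (Uk qh n) (Uk qh n)) (hD : is_coproduct D).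

Definition coproduct_flip_Uk (u : Uk qh n) : Prop :=
  exists2 s : seq (Uk qh n * Uk qh n),
    D u = \sum_(p <- s) tensor p.1 p.2 &
    D (S u) = \sum_(p <- s) tensor (S p.2) (S p.1).

(** The hypothesis ranges over all generic coproducts and antipodes because [is_coproduct] and
    [is_antipode] only assert that suitable ones exist. *)
Lemma coproduct_flip_base_change (u : Uint n) :
    (forall Dv Sv, @generic_coproduct n Dv -> @generic_antipode n Sv ->
      coproduct_flip Dv Sv (val u)) ->
  coproduct_flip_Uk (bc u).
Proof.
move=> hflip; case: (hD) => _ [Dv hDv hDbc].
case: antipode_base_change => Sv hSv hSbc.
case: (hflip _ _ hDv hSv) => s h1 h2.
(* An integral lift of the generic antipode: the tensors in the expansion of Delta(S u) must also
   have factors in the integral form before they can be specialised. *)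
pose Si v := s2val (cid2 (hSbc v)).
have SiE v : val (Si v) = Sv (val v) by rewrite /Si; case: cid2.
have SbcE v : S (bc v) = bc (Si v) by rewrite /Si; case: cid2.
exists [seq (bc p.1, bc p.2) | p <- s].
  by rewrite big_map (hDbc _ _ h1).
rewrite big_map SbcE (hDbc (Si u) [seq (Si p.2, Si p.1) | p <- s]).
  by rewrite big_map; apply: eq_bigr => p _; rewrite !SbcE.
by rewrite big_map SiE h2; apply: eq_bigr => p _; rewrite !SiE.
Qed.

End Antipode.
End BaseChange.

Lemma linear_scale (K : fieldType) (U V : lmodType K) (f : U -> V) a u :
  linear f -> f (a *: u) = a *: f u.
Proof.
move=> hf; pose F : {linear U -> V} := HB.pack f (GRing.isLinear.Build _ _ _ _ f hf).
by rewrite -[f]/(F : U -> V) linearZ.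
Qed.

Lemma linear_expand (K : fieldType) (U V : lmodType K) (I : finType) (f : U -> V)
    (a : I -> K) (u : I -> U) :
  linear f -> f (\sum_i a i *: u i) = \sum_i a i *: f (u i).
Proof.
move=> hf; pose F : {linear U -> V} := HB.pack f (GRing.isLinear.Build _ _ _ _ f hf).
rewrite -[f]/(F : U -> V) linear_sum; apply: eq_bigr => i _; exact: linearZ.
Qed.

(** * The form on tensor powers *)

Section Form.
Variables (kappa : fieldType) (n : nat) (c : 'I_n.*2.+1 -> kappa).
Local Notation N := n.*2.+1.
Local Notation index s := {ffun 'I_s -> 'I_N}.

Lemma tpow_linE s a (u w : tpow kappa n s) k : (a *: u + w) k = a * u k + w k.
Proof. by rewrite !ffunE. Qed.

Lemma tpow_scaleE s a (u : tpow kappa n s) k : (a *: u) k = a * u k.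
Proof. by rewrite !ffunE. Qed.

Definition flip_index s (k : index s) : index s :=
  [ffun i => rev_ord (k (rev_ord i))].

Lemma flip_indexK s : involutive (@flip_index s).
Proof. by move=> k; apply/ffunP => i; rewrite !ffunE !rev_ordK. Qed.

Definition weight s (k : index s) : kappa := \prod_i c (k i).

Definition form s (x y : tpow kappa n s) : kappa :=
  \sum_(k : index s) weight k * x k * y (flip_index k).

Lemma form_basisl s (k : index s) y :
  form (tbasis kappa k) y = weight k * y (flip_index k).
Proof.
rewrite /form (bigD1 k) //= ffunE eqxx mulr1 big1 ?addr0 // => l hl.
by rewrite ffunE (negbTE hl) mulr0 mul0r.
Qed.

Lemma form_basis s (k l : index s) :
  form (tbasis kappa k) (tbasis kappa l) = weight k * (flip_index k == l)%:R.
Proof. by rewrite form_basisl ffunE. Qed.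

Lemma form_linearl s y : linear ((fun x => form x y) : tpow kappa n s -> kappa^o).
Proof.
move=> a u w; change (form (a *: u + w) y = a * form u y + form w y).
rewrite /form mulr_sumr -big_split.
by apply: eq_bigr => k _; rewrite tpow_linE /=; ring.
Qed.

Lemma form_linearr s x : linear (form x : tpow kappa n s -> kappa^o).
Proof.
move=> a u w; change (form x (a *: u + w) = a * form x u + form x w).
rewrite /form mulr_sumr -big_split.
by apply: eq_bigr => k _; rewrite tpow_linE /=; ring.
Qed.

Lemma formDl s (u w y : tpow kappa n s) : form (u + w) y = form u y + form w y.
Proof. by have := form_linearl y 1 u w; rewrite !scale1r. Qed.

Lemma formDr s (x u w : tpow kappa n s) : form x (u + w) = form x u + form x w.
Proof. by have := form_linearr x 1 u w; rewrite !scale1r. Qed.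

Lemma form0l s (y : tpow kappa n s) : form 0 y = 0.
Proof. by apply: (addIr (form 0 y)); rewrite -formDl addr0 add0r. Qed.

Lemma form0r s (x : tpow kappa n s) : form x 0 = 0.
Proof. by apply: (addIr (form x 0)); rewrite -formDr addr0 add0r. Qed.

Lemma formZl s a (u y : tpow kappa n s) : form (a *: u) y = a * form u y.
Proof. by have := form_linearl y a u 0; rewrite !addr0 form0l addr0. Qed.

Lemma formZr s a (x u : tpow kappa n s) : form x (a *: u) = a * form x u.
Proof. by have := form_linearr x a u 0; rewrite !addr0 form0r addr0. Qed.

Lemma formNl s (u y : tpow kappa n s) : form (- u) y = - form u y.
Proof. by rewrite -scaleN1r formZl mulN1r. Qed.

Lemma formNr s (x u : tpow kappa n s) : form x (- u) = - form x u.
Proof. by rewrite -scaleN1r formZr mulN1r. Qed.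

Lemma form_suml s (I : Type) (r : seq I) (P : pred I) F (y : tpow kappa n s) :
  form (\sum_(i <- r | P i) F i) y = \sum_(i <- r | P i) form (F i) y.
Proof. exact: (big_morph (fun x => form x y) (fun u w => formDl u w y) (form0l y)). Qed.

Lemma form_sumr s (I : Type) (r : seq I) (P : pred I) F (x : tpow kappa n s) :
  form x (\sum_(i <- r | P i) F i) = \sum_(i <- r | P i) form x (F i).
Proof. exact: (big_morph (form x) (formDr x) (form0r x)). Qed.

Lemma tpow_expand s (x : tpow kappa n s) : x = \sum_k x k *: tbasis kappa k.
Proof.
apply/ffunP => l; rewrite sum_ffunE (bigD1 l) //= tpow_scaleE ffunE eqxx mulr1.
rewrite big1 ?addr0 // => k hk.
by rewrite tpow_scaleE ffunE eq_sym (negbTE hk) mulr0.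
Qed.

Lemma form_adjoint_basis s (f g : tpow kappa n s -> tpow kappa n s) :
    linear f -> linear g ->
    (forall k l, form (f (tbasis kappa k)) (tbasis kappa l) =
                 form (tbasis kappa k) (g (tbasis kappa l))) ->
  forall x y, form (f x) y = form x (g y).
Proof.
move=> hf hg h x y; rewrite [x]tpow_expand [y]tpow_expand.
rewrite !linear_expand // !form_suml; apply: eq_bigr => k _.
rewrite !form_sumr; apply: eq_bigr => l _.
by rewrite !formZl !formZr h.
Qed.

(* [tpow] at [s + 1] and at [1 + s] are different types; reversing the order of
   the factors requires a transport between them. *)
Definition castt s t (e : s = t) (x : tpow kappa n s) : tpow kappa n t :=
  [ffun k : index t => x [ffun i => k (cast_ord e i)]].

Lemma castt_id s (e : s = s) x : castt e x = x.
Proof.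
apply/ffunP => k; rewrite ffunE; congr (x _); apply/ffunP => i; rewrite ffunE.
by rewrite cast_ord_id.
Qed.

Lemma castt_sum s t (e : s = t) (I : Type) (r : seq I) (P : pred I) F :
  castt e (\sum_(i <- r | P i) F i) = \sum_(i <- r | P i) castt e (F i).
Proof. by case: t / e; rewrite castt_id; apply: eq_bigr => i _; rewrite castt_id. Qed.

Definition index_cat s t (k : index s) (l : index t) : index (s + t) :=
  [ffun i => match split i with inl j => k j | inr j => l j end].

Definition index_left s t (k : index (s + t)) : index s := [ffun i => k (lshift t i)].
Definition index_right s t (k : index (s + t)) : index t := [ffun i => k (rshift s i)].

Lemma index_catl s t (k : index s) (l : index t) i : index_cat k l (lshift t i) = k i.
Proof. by rewrite ffunE (unsplitK (inl i)). Qed.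

Lemma index_catr s t (k : index s) (l : index t) i : index_cat k l (rshift s i) = l i.
Proof. by rewrite ffunE (unsplitK (inr i)). Qed.

Lemma index_catK s t (k : index (s + t)) : index_cat (index_left k) (index_right k) = k.
Proof.
by apply/ffunP => i; case: (split_ordP i) => j ->; rewrite ?index_catl ?index_catr ffunE.
Qed.

Lemma index_cat_left s t (k : index s) (l : index t) : index_left (index_cat k l) = k.
Proof. by apply/ffunP => i; rewrite ffunE index_catl. Qed.

Lemma index_cat_right s t (k : index s) (l : index t) : index_right (index_cat k l) = l.
Proof. by apply/ffunP => i; rewrite ffunE index_catr. Qed.

Lemma tbasis_cat s t (k : index s) (l : index t) :
  tbasis kappa (index_cat k l) = tcat (tbasis kappa k) (tbasis kappa l).
Proof.
apply/ffunP => m; rewrite !ffunE -natrM mulnb; congr (_%:R); congr (nat_of_bool _).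
apply/eqP/andP => [->|[/eqP h1 /eqP h2]].
  by rewrite -{2}(index_cat_left k l) -{4}(index_cat_right k l); split; apply/eqP.
by rewrite -h1 -h2 -[LHS]index_catK.
Qed.

Lemma castt_basis s t (e : s = t) (k : index s) :
  castt e (tbasis kappa k) = tbasis kappa [ffun i => k (cast_ord (esym e) i)].
Proof.
case: t / e; rewrite castt_id; congr tbasis; apply/ffunP => i.
by rewrite ffunE cast_ord_id.
Qed.

(** Reversing positions exchanges the two blocks of a concatenated index, so the partner of x (x) x'
    is y' (x) y. *)
Lemma form_tcat s t (x y : tpow kappa n s) (x' y' : tpow kappa n t) :
  form (tcat x x') (castt (addnC t s) (tcat y' y)) = form x y * form x' y'.
Proof.
rewrite /form big_distrlr /= pair_bigA /=.
rewrite (reindex (fun p : index s * index t => index_cat p.1 p.2)) /=; last first.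
  exists (fun k => (index_left k, index_right k)) => [[k l] _|k _] /=.
    by rewrite index_cat_left index_cat_right.
  exact: index_catK.
apply: eq_bigr => -[k l] _ /=.
have -> : weight (index_cat k l) = weight k * weight l.
  rewrite /weight big_split_ord; congr (_ * _); apply: eq_bigr => i _.
    by rewrite index_catl.
  by rewrite index_catr.
have -> : tcat x x' (index_cat k l) = x k * x' l.
  by rewrite ffunE -/(index_left _) -/(index_right _) index_cat_left index_cat_right.
have -> : castt (addnC t s) (tcat y' y) (flip_index (index_cat k l)) =
    y' (flip_index l) * y (flip_index k).
  rewrite 2!ffunE; congr (y' _ * y _); apply/ffunP => i;
    rewrite 3!ffunE [RHS]ffunE.
    rewrite -(index_catr k l); congr (rev_ord (index_cat k l _)).
    by apply: val_inj => /=; have := ltn_ord i; lia.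
  rewrite -(index_catl k l); congr (rev_ord (index_cat k l _)).
  by apply: val_inj => /=; have := ltn_ord i; lia.
by ring.
Qed.

Hypothesis c_neq0 : forall i, c i != 0.

Lemma weight_neq0 s (k : index s) : weight k != 0.
Proof. by apply/prodf_neq0. Qed.

Definition form_dual s (x : tpow kappa n s) : dual (tpow kappa n s) :=
  linfun (form x : tpow kappa n s -> kappa^o).

Lemma form_dualE s (x y : tpow kappa n s) : form_dual x y = form x y.
Proof.
pose F : {linear tpow kappa n s -> kappa^o} :=
  HB.pack (form x : tpow kappa n s -> kappa^o)
    (GRing.isLinear.Build _ _ _ _ _ (form_linearr x)).
exact: (lfunE F).
Qed.

Lemma form_dual_linear s : linear (@form_dual s).
Proof.
move=> a u w; apply/lfunP => y; rewrite add_lfunE scale_lfunE !form_dualE.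
exact: form_linearl.
Qed.

(** Each basis vector pairs nontrivially with exactly one basis vector, so the inverse reads off a
    coordinate and divides by the weight. *)
Lemma form_dual_bij s : bijective (@form_dual s).
Proof.
exists (fun phi : dual (tpow kappa n s) =>
    [ffun k => (weight k)^-1 * phi (tbasis kappa (flip_index k))] : tpow kappa n s).
  move=> x; apply/ffunP => k; rewrite ffunE form_dualE.
  rewrite /form (bigD1 k) //= ffunE eqxx mulr1 big1 => [|l hl].
    by rewrite addr0 mulKf ?weight_neq0.
  by rewrite ffunE (inj_eq (inv_inj (@flip_indexK s))) (negbTE hl) mulr0.
move=> phi; apply/lfunP => y; rewrite form_dualE.
rewrite /form [in RHS](tpow_expand y) linear_sum.
rewrite (reindex_inj (inv_inj (@flip_indexK s))) /=; apply: eq_bigr => k _.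
by rewrite ffunE flip_indexK linearZ mulVKf ?weight_neq0 // mulrC.
Qed.

End Form.

(** * The form and the BMW algebra *)

Lemma sum_delta_antidiag (K : fieldType) (m : nat) (P : pred 'I_m) (f : 'I_m -> K) a b :
  (\sum_(i | P i) f i *: delta_mx (rev_ord i) i) a b =
  ((a == rev_ord b) && P b)%:R * f b.
Proof.
rewrite summxE; have [hb|hb] := boolP (P b); last first.
  rewrite andbF mul0r big1 // => i hi; rewrite !mxE.
  by case: (b =P i) hb => [->|_] h; rewrite ?hi // andbF mulr0 in h *.
rewrite (bigD1 b) //= !mxE eqxx andbT mulrC big1 ?addr0 // => i /andP[_ hi].
by rewrite !mxE [b == i]eq_sym (negbTE hi) andbF mulr0.
Qed.

Lemma rev_ord_eq m (i j : 'I_m) : (rev_ord i == j) = (i == rev_ord j).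
Proof. by rewrite -(inj_eq rev_ord_inj) rev_ordK. Qed.

Lemma eq_rev_ord m (i j : 'I_m) : (i == rev_ord j) = (j == rev_ord i).
Proof. by rewrite -rev_ord_eq eq_sym. Qed.

Section BraidForm.
Variables (kappa : fieldType) (n : nat) (q qh : kappa).
Hypotheses (hqh : qh ^+ 2 = q) (hq0 : q != 0).
Local Notation N := n.*2.+1.
Implicit Types i k l a b : 'I_N.

Definition form_coef (i : 'I_N) : kappa := qh ^ (- rho2 i).

Lemma qh_neq0 : qh != 0.
Proof. by apply: contraNneq hq0 => h; rewrite -hqh h expr0n. Qed.

Lemma form_coef_neq0 i : form_coef i != 0.
Proof. by rewrite expfz_neq0 ?qh_neq0. Qed.

Lemma rho2_rev i : rho2 (rev_ord i) = - rho2 i.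
Proof. by have := ltn_ord i; rewrite /rho2 /=; do !case: ifP => /=; lia. Qed.

Lemma form_coef_rev i : form_coef i * form_coef (rev_ord i) = 1.
Proof. by rewrite /form_coef rho2_rev -expfzDr ?qh_neq0 // subrr. Qed.

Lemma mid_val : mid n = n :> nat.
Proof. by rewrite /mid inordK //; lia. Qed.

(** One formula in place of the case table: an exchange term, a diagonal term and a cap term, which
    can be compared separately. The middle vector is its own mirror image, whence the coefficient 1
    when k = l = l'. *)
Lemma Rcheck_entry k l a b : Rcheck q qh k l a b =
  ((a == l) && (b == k))%:R *
    (if k == l then if k == rev_ord l then 1 else q
     else if k == rev_ord l then q^-1 else 1)
  + (q - q^-1) * [&& (k < l)%N, a == k & b == l]%:R
  - (q - q^-1) * ([&& k == rev_ord l, a == rev_ord b & (k < b)%N]%:R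
       * qh ^ (rho2 b - rho2 k)).
Proof.
have hmid i : (i == mid n) = (i == n :> nat) by rewrite -val_eqE /= mid_val.
have hrev i j : (i == rev_ord j) = (i + j == n.*2)%N.
  by rewrite -val_eqE /=; have := ltn_ord i; have := ltn_ord j; lia.
rewrite /Rcheck /cap_tail; case: ifP => [/andP[hk hl]|hm].
  move: (eqP hk) (eqP hl) => -> ->.
  rewrite eqxx ltnn andFb mulr0 addr0.
  rewrite hrev mid_val addnn eqxx mulr1 !mxE sum_delta_antidiag.
  have -> : rho2 (mid n) = 0 by rewrite /rho2 mid_val ltnn eqxx.
  by rewrite subr0.
have [hkl|hkl] := eqVneq k l.
  subst l; rewrite hmid andbb in hm; rewrite ltnn /= mulr0 addr0.
  have -> : (k == rev_ord k) = false by rewrite hrev; lia.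
  by rewrite mul0r mulr0 subr0 !mxE mulrC.
have [hlt|hge] := ltnP l k; have [hc|hc] /= := eqVneq k (rev_ord l).
- have -> : (k < l)%N = false by lia.
  by rewrite /= mulr0 addr0 !mxE sum_delta_antidiag [_%:R * q^-1]mulrC.
- have -> : (k < l)%N = false by lia.
  by rewrite /= mulr0 addr0 mul0r mulr0 subr0 mulr1 !mxE.
- have -> : (k < l)%N by rewrite ltn_neqAle hge andbT.
  rewrite !mxE sum_delta_antidiag [_%:R * q^-1]mulrC.
  by rewrite mulrBr addrA.
- have -> : (k < l)%N by rewrite ltn_neqAle hge andbT.
  by rewrite mul0r mulr0 subr0 mulr1 !mxE.
Qed.

(** Self-adjointness of M on V (x) V for the reversed form, tested on v_k (x) v_l and v_(b') (x)
    v_(a'). *)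
Definition form_symmetric (M : 'I_N -> 'I_N -> 'M[kappa]_N) : Prop :=
  forall k l a b, M k l a b * (form_coef a * form_coef b) =
    M (rev_ord b) (rev_ord a) (rev_ord l) (rev_ord k) * (form_coef k * form_coef l).

(** Each of the three terms is symmetric by itself. In the first two, {a, b} = {k, l}, so the
    weights agree; in the cap term both weights are 1 and rho_(i') = -rho_i matches the
    exponents. *)
Lemma Rcheck_symmetric : form_symmetric (Rcheck q qh).
Proof.
move=> k l a b; rewrite !Rcheck_entry; move: (q - q^-1) => delta.
rewrite !mulrBl !mulrDl.
rewrite !(inj_eq rev_ord_inj).
have revlt (i j : 'I_N) : (rev_ord i < rev_ord j)%N = (j < i)%N.
  by rewrite /=; have := ltn_ord i; have := ltn_ord j; lia.
congr (_ + _ - _).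
- rewrite [(l == a)]eq_sym [(k == b)]eq_sym.
  have [->|_] := eqVneq a l; last by rewrite !mul0r.
  have [->|_] := eqVneq b k; last by rewrite !mul0r.
  by rewrite [form_coef l * _]mulrC.
- rewrite !revlt [l == b]eq_sym [k == a]eq_sym.
  have [->|_] := eqVneq a k; last by rewrite !(andbF, andFb) mulr0n !(mul0r, mulr0).
  have [->|_] := eqVneq b l; last by rewrite !(andbF, andFb) mulr0n !(mul0r, mulr0).
  by [].
- rewrite revlt [b == _]eq_rev_ord [l == _]eq_rev_ord.
  have [->|_] := eqVneq k (rev_ord l); last first.
    by rewrite !(andbF, andFb) mulr0n !(mul0r, mulr0).
  have [->|_] := eqVneq a (rev_ord b); last first.
    by rewrite !(andbF, andFb) mulr0n !(mul0r, mulr0).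
  rewrite [form_coef (rev_ord b) * _]mulrC [form_coef (rev_ord l) * _]mulrC.
  by rewrite !form_coef_rev !rho2_rev !opprK [rho2 l + _]addrC.
Qed.

Lemma Emap_entry k l a b : Emap qh k l a b =
  ((k == rev_ord l) && (b == rev_ord a))%:R * qh ^ (- rho2 a - rho2 k).
Proof.
rewrite /Emap; case: eqP => _; last by rewrite mxE mul0r.
rewrite summxE (bigD1 a) //= !mxE eqxx rho2_rev mulrC big1 ?addr0 // => i hi.
by rewrite !mxE eq_sym (negbTE hi) mulr0.
Qed.

Lemma Emap_symmetric : form_symmetric (Emap qh).
Proof.
move=> k l a b; rewrite !Emap_entry !rev_ordK !rho2_rev.
have [->|hk] := eqVneq k (rev_ord l); last first.
  by rewrite [rev_ord k == l]rev_ord_eq (negbTE hk) andbF mulr0n !mul0r.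
have [->|hb] := eqVneq b (rev_ord a); last first.
  by rewrite rev_ord_eq (negbTE hb) andbF mulr0n !mul0r.
rewrite !rev_ordK !eqxx !rho2_rev /= !mul1r form_coef_rev.
by rewrite [form_coef (rev_ord l) * _]mulrC form_coef_rev opprK addrC opprK.
Qed.

End BraidForm.

Section OnFactors.
Variables (kappa : fieldType) (n : nat) (q qh : kappa).
Hypotheses (hqh : qh ^+ 2 = q) (hq0 : q != 0).
Variable r : nat.
Local Notation N := n.*2.+1.
Local Notation index := {ffun 'I_r -> 'I_N}.
Local Notation c := (form_coef (n := n) qh).
Implicit Types (i : 'I_r.-1) (k l m : index).

Lemma fstpos_neq_sndpos i : (sndpos i == fstpos i) = false.
Proof. by rewrite -val_eqE /=; lia. Qed.

Lemma fstpos_rev i : fstpos (rev_ord i) = rev_ord (sndpos i).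
Proof. by apply: val_inj => /=; have := ltn_ord i; lia. Qed.

Lemma sndpos_rev i : sndpos (rev_ord i) = rev_ord (fstpos i).
Proof. by apply: val_inj => /=; have := ltn_ord i; lia. Qed.

Definition replace2 i k (a b : 'I_N) : index :=
  [ffun j => if j == fstpos i then a else if j == sndpos i then b else k j].

Definition agree_off i k m : bool :=
  [forall j, (j != fstpos i) && (j != sndpos i) ==> (k j == m j)].

Lemma on_factors_basis (M : 'I_N -> 'I_N -> 'M[kappa]_N) i k :
  on_factors M i (tbasis kappa k) =
  \sum_a \sum_b M (k (fstpos i)) (k (sndpos i)) a b *: tbasis kappa (replace2 i k a b).
Proof.
rewrite /on_factors (bigD1 k) //= ffunE eqxx scale1r [X in _ + X]big1 ?addr0 // => l hl.
by rewrite ffunE (negbTE hl) scale0r.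
Qed.

Lemma replace2_eq i k m a b : (replace2 i k a b == m) =
  [&& agree_off i k m, a == m (fstpos i) & b == m (sndpos i)].
Proof.
apply/eqP/and3P => [<-|[/forallP h /eqP -> /eqP ->]].
  rewrite !ffunE !eqxx fstpos_neq_sndpos; split=> //.
  apply/forallP => j; apply/implyP => /andP[h1 h2].
  by rewrite ffunE (negbTE h1) (negbTE h2).
apply/ffunP => j; rewrite ffunE; case: eqP => [->//|/eqP h1].
case: eqP => [->//|/eqP h2]; apply/eqP; have := h j.
by rewrite h1 h2.
Qed.

Lemma sum_replace2 i k m (G : 'I_N -> 'I_N -> kappa) :
  \sum_a \sum_b G a b * (replace2 i k a b == m)%:R =
  (agree_off i k m)%:R * G (m (fstpos i)) (m (sndpos i)).
Proof.
rewrite (bigD1 (m (fstpos i))) //= [X in _ + X]big1 ?addr0; last first.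
  by move=> a ha; rewrite big1 // => b _; rewrite replace2_eq (negbTE ha) andbF mulr0.
rewrite (bigD1 (m (sndpos i))) //= [X in _ + X]big1 ?addr0; last first.
  by move=> b hb; rewrite replace2_eq (negbTE hb) !andbF mulr0.
by rewrite replace2_eq !eqxx !andbT mulrC.
Qed.

Lemma weight_agree i k m : agree_off i k m ->
  weight c m * (c (k (fstpos i)) * c (k (sndpos i))) =
  weight c k * (c (m (fstpos i)) * c (m (sndpos i))).
Proof.
move=> /forallP h.
have wE (l : index) : weight c l = c (l (fstpos i)) * c (l (sndpos i)) *
    \prod_(j | (j != fstpos i) && (j != sndpos i)) c (l j).
  rewrite /weight (bigD1 (fstpos i)) //= (bigD1 (sndpos i)) ?mulrA //.
  by rewrite fstpos_neq_sndpos.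
rewrite (wE m) (wE k).
have -> : \prod_(j | (j != fstpos i) && (j != sndpos i)) c (k j) =
    \prod_(j | (j != fstpos i) && (j != sndpos i)) c (m j).
  by apply: eq_bigr => j hj; have := h j; rewrite hj => /eqP ->.
by ring.
Qed.

Lemma agree_off_flip i k l :
  agree_off (rev_ord i) l (flip_index k) = agree_off i k (flip_index l).
Proof.
apply/forallP/forallP => h j; have := h (rev_ord j); rewrite !ffunE rev_ordK.
  by rewrite fstpos_rev sndpos_rev !(inj_eq rev_ord_inj) andbC [l _ == _]eq_rev_ord.
rewrite fstpos_rev sndpos_rev ![j == rev_ord _]eq_rev_ord [k _ == _]eq_rev_ord.
by rewrite ![_ == rev_ord j]eq_sym andbC.
Qed.

Lemma form_on_factors (M : 'I_N -> 'I_N -> 'M[kappa]_N) i k l :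
    form_symmetric qh M ->
  form c (on_factors M i (tbasis kappa k)) (tbasis kappa l) =
  form c (tbasis kappa k) (on_factors M (rev_ord i) (tbasis kappa l)).
Proof.
move=> hM; rewrite !on_factors_basis form_suml form_sumr.
pose G a b := M (k (fstpos i)) (k (sndpos i)) a b * weight c (flip_index l).
transitivity (\sum_a \sum_b G a b * (replace2 i k a b == flip_index l)%:R).
  apply: eq_bigr => a _; rewrite form_suml; apply: eq_bigr => b _.
  rewrite formZl form_basis -(inj_eq (inv_inj (@flip_indexK n r))) flip_indexK.
  by rewrite /G; case: eqP => [->|_]; rewrite ?mulr1 ?mulr0.
pose G' a b := M (l (fstpos (rev_ord i))) (l (sndpos (rev_ord i))) a b * weight c k.
transitivity
    (\sum_a \sum_b G' a b * (replace2 (rev_ord i) l a b == flip_index k)%:R); last first.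
  apply: eq_bigr => a _; rewrite form_sumr; apply: eq_bigr => b _.
  by rewrite formZr form_basis eq_sym mulrA.
rewrite !sum_replace2 agree_off_flip.
have [hag|_] := boolP (agree_off i k (flip_index l)); last by rewrite !mul0r.
rewrite !mul1r /G /G' fstpos_rev sndpos_rev !ffunE !rev_ordK.
have c0 j : c j != 0 by apply: form_coef_neq0 hqh hq0 j.
(* With this factor [weight_agree] trades the weight of the flipped [l] for that of [k], and what
   remains is the symmetry of M at a = l1', b = l0'. *)
apply: (mulIf (mulf_neq0 (c0 (k (fstpos i))) (c0 (k (sndpos i))))).
rewrite -[LHS]mulrA (weight_agree hag) !ffunE.
set l0 := l (rev_ord (sndpos i)); set l1 := l (rev_ord (fstpos i)).
set k0 := k (fstpos i); set k1 := k (sndpos i).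
have := hM k0 k1 (rev_ord l1) (rev_ord l0); rewrite !rev_ordK => h.
rewrite [RHS]mulrAC -h; ring.
Qed.

End OnFactors.

(** * The form and the quantum group *)

Ltac decide_eqs := repeat match goal with |- context [@eq_op ?T ?a ?b] =>
  first [ have -> : (@eq_op T a b) = true by lia
        | have -> : (@eq_op T a b) = false by lia ] end.

Section NaturalForm.
Variables (kappa : fieldType) (n : nat) (q qh : kappa).
Hypotheses (hqh : qh ^+ 2 = q) (hq0 : q != 0).
Local Notation N := n.*2.+1.
Local Notation form := (form (form_coef (n := n) qh)).
Local Notation vb := (vb kappa n).
Implicit Types j l : nat.

Definition label_coef j : kappa := form_coef qh (inord j.-1 : 'I_N).

Lemma form_vb j l : (0 < j <= N)%N -> (0 < l <= N)%N ->
  form (vb j) (vb l) = label_coef j * (j + l == n.*2.+2)%:R.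
Proof.
move=> hj hl; rewrite form_basis /weight big_ord1 ffunE; congr (_ * _%:R).
congr nat_of_bool; apply/eqP/eqP => [/ffunP/(_ ord0)|h].
  rewrite !ffunE => /(congr1 (@nat_of_ord _)) /=; rewrite !inordK; lia.
by apply/ffunP => i; rewrite !ffunE; apply: val_inj; rewrite /= !inordK; lia.
Qed.

Let qh0 : qh != 0 := qh_neq0 hqh hq0.

Lemma label_coefS j : (0 < j < N)%N ->
  label_coef j.+1 = (if (j == n) || (j == n.+1) then qh else q) * label_coef j.
Proof.
move=> hj; rewrite /label_coef /form_coef.
have -> : (if (j == n) || (j == n.+1) then qh else q) =
    qh ^ (if (j == n) || (j == n.+1) then 1 else 2 : int).
  by case: ifP => // _; rewrite -hqh.
rewrite -expfzDr //; congr (_ ^ _); rewrite /rho2 !inordK; try lia.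
by do !case: ifP => /=; lia.
Qed.

Ltac eval_form := decide_eqs; rewrite /= ?formZl ?formZr ?formNl ?formNr ?formZl ?formZr
  ?form0l ?form0r ?form_vb; try lia; decide_eqs;
  rewrite ?(mulr0, mulr1, mul0r, oppr0, mul1r) //.

Lemma label_coef_step j k : (0 < j < N)%N -> k = j.+1 -> (j != n) && (j != n.+1) ->
  label_coef k = q * label_coef j.
Proof.
by move=> hj -> /andP[/negbTE h1 /negbTE h2]; rewrite label_coefS // h1 h2.
Qed.

Lemma label_coef_half j k : (0 < j < N)%N -> k = j.+1 -> (j == n) || (j == n.+1) ->
  label_coef k = qh * label_coef j.
Proof. by move=> hj -> h; rewrite label_coefS // h. Qed.

(** This is <e x, y> = <x, S(e) y> with the k^-1 of S(e) = -k^-1 e moved to the left argument, where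
    k acts by a scalar. Each nonzero case amounts to one ratio of consecutive coefficients. *)
Lemma form_e_act i j l : (0 < i <= n)%N -> (0 < j <= N)%N -> (0 < l <= N)%N ->
  form (e_act n qh i j) (vb l) =
  - (k_act n q i j * form (vb j) (e_act n qh i l)).
Proof.
move=> hi hj hl; rewrite /e_act /k_act /prm; case: ifP => hin.
- case: (eqVneq j i.+1) => ?; last case: (eqVneq j (n.*2.+2 - i)%N) => ?;
    (case: (eqVneq l i.+1) => ?; last case: (eqVneq l (n.*2.+2 - i)%N) => ?);
    eval_form.
  + rewrite (@label_coef_step i j) //; try lia.
    by field.
  + rewrite (@label_coef_step (n.*2.+2 - i.+1) j) //; try lia.
    by field.
- have ein : i = n by lia.
  case: (eqVneq j n.+1) => ?; last case: (eqVneq j (n.*2.+2 - n)%N) => ?;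
    (case: (eqVneq l n.+1) => ?; last case: (eqVneq l (n.*2.+2 - n)%N) => ?);
    eval_form.
  + rewrite (@label_coef_half n j) //; try lia.
    by field.
  + rewrite (@label_coef_half n.+1 j) //; try lia.
    by rewrite -hqh; field.
Qed.

(** Here S(f) = -f k, so k acts on v_l before f does; hence the scalar at [l] instead of [j]. *)
Lemma form_f_act i j l : (0 < i <= n)%N -> (0 < j <= N)%N -> (0 < l <= N)%N ->
  form (f_act n qh i j) (vb l) =
  - (k_act n q i l * form (vb j) (f_act n qh i l)).
Proof.
move=> hi hj hl; rewrite /f_act /k_act /prm; case: ifP => hin.
- case: (eqVneq j i) => ?; last case: (eqVneq j (n.*2.+2 - i.+1)%N) => ?;
    (case: (eqVneq l i) => ?; last case: (eqVneq l (n.*2.+2 - i.+1)%N) => ?);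
    eval_form.
  + rewrite (@label_coef_step j i.+1) //; try lia.
    by ring.
  + rewrite (@label_coef_step j (n.*2.+2 - i)) //; try lia.
- have ein : i = n by lia.
  case: (eqVneq j n) => ?; last case: (eqVneq j n.+1) => ?;
    (case: (eqVneq l n) => ?; last case: (eqVneq l n.+1) => ?);
    eval_form.
  + rewrite (@label_coef_half j n.+1) //; try lia.
    by ring.
  + rewrite (@label_coef_half j (n.*2.+2 - n)) //; try lia.
    by rewrite -hqh; ring.
Qed.

(** The scalar is that of [antipode_e_int], the conditional being d_i. The one new case is m = 2, i
    = n, j = l = n', where two half steps give c_(n') = q c_n. *)
Lemma form_e_divpow_act i m j l :
    (0 < i <= n)%N -> (0 < j <= N)%N -> (0 < l <= N)%N ->
  form (e_divpow_act n qh i m j) (vb l) =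
  (-1) ^+ m * qh ^+ ((if (i < n)%N then 2 else 1) * (m * m.-1)) *
    (k_act n q i j ^+ m * form (vb j) (e_divpow_act n qh i m l)).
Proof.
move=> hi hj hl; case: m => [|[|[|m]]] /=.
- by rewrite !muln0 !expr0 !mul1r.
- by rewrite form_e_act // !muln0 expr0 !expr1 mulr1 mulN1r.
- case: (eqVneq i n) => ein; last by rewrite form0l form0r !mulr0.
  rewrite /k_act /prm; case: (eqVneq j (n.*2.+2 - n)%N) => ?;
    case: (eqVneq l (n.*2.+2 - n)%N) => ?; eval_form.
  have -> : (i < n)%N = false by lia.
  rewrite (@label_coef_half n.+1 j) //; try lia.
  rewrite (@label_coef_half n n.+1) //; try lia.
  by rewrite -hqh; move: (qint2 qh)^-1 (label_coef n) => t a; field.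
- by rewrite form0l form0r !mulr0.
Qed.

Lemma form_f_divpow_act i m j l :
    (0 < i <= n)%N -> (0 < j <= N)%N -> (0 < l <= N)%N ->
  form (f_divpow_act n qh i m j) (vb l) =
  (-1) ^+ m / qh ^+ ((if (i < n)%N then 2 else 1) * (m * m.-1)) *
    (k_act n q i l ^+ m * form (vb j) (f_divpow_act n qh i m l)).
Proof.
move=> hi hj hl; case: m => [|[|[|m]]] /=.
- by rewrite !muln0 !expr0 divr1 !mul1r.
- by rewrite form_f_act // !muln0 expr0 !expr1 divr1 mulN1r.
- case: (eqVneq i n) => ein; last by rewrite form0l form0r !mulr0.
  rewrite /k_act /prm; case: (eqVneq j n) => ?;
    case: (eqVneq l n) => ?; eval_form.
  have -> : (i < n)%N = false by lia.
  rewrite (@label_coef_half n.+1 (n.*2.+2 - n)) //; try lia.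
  rewrite (@label_coef_half j n.+1) //; try lia.
  by rewrite -hqh; move: (qint2 qh) (label_coef _) => t a; field.
- by rewrite form0l form0r !mulr0.
Qed.

End NaturalForm.

(** * Invariance under the quantum group on all tensor powers *)

Section LeftAdjoint.
Variables (kappa : fieldType) (n : nat) (q qh : kappa).
Hypotheses (hqh : qh ^+ 2 = q) (hq0 : q != 0).
Local Notation N := n.*2.+1.
Local Notation form := (form (form_coef (n := n) qh)).
Local Notation U := (Uk qh n).
Local Notation bc := (@base_change kappa qh n).
Variables (D : U -> tensor_alg U U) (hD : is_coproduct D).
Variables (S : U -> U) (hS : is_antipode S).
Variables (L : forall s, U -> tpow kappa n s -> tpow kappa n s).
Arguments L {s}.
Hypotheses (hV : natural_rep q (@L 1)) (hL : tensor_power_modules D (@L)).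

Let hSa : alg_antihom S := proj1 hS.

Definition left_adjoint s (u : U) : Prop :=
  forall x y : tpow kappa n s, form (L u x) y = form x (L (S u) y).

Lemma left_adjoint_basis s u : (0 < s)%N ->
    (forall k l : {ffun 'I_s -> 'I_N}, form (L u (tbasis kappa k)) (tbasis kappa l) =
                 form (tbasis kappa k) (L (S u) (tbasis kappa l))) ->
  left_adjoint s u.
Proof.
move=> hs h; case: (hL.1 s hs) => lin _ _ _.
exact: form_adjoint_basis.
Qed.

Lemma left_adjoint_all s : (0 < s)%N ->
    (forall i m, left_adjoint s (bc (e_int i m))) ->
    (forall i m, left_adjoint s (bc (f_int i m))) ->
    (forall i, left_adjoint s (bc (k_int i))) ->
  forall u, left_adjoint s u.
Proof.
move=> hs he hf hk; case: (hL.1 s hs) => lin Lc LD LM; case: (hSa) => Sc SD SM.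
apply: Uk_ind => //.
- by move=> a x y; rewrite Sc !Lc formZl formZr.
- by move=> u w hu hw x y; rewrite SD !LD formDl formDr hu hw.
- by move=> u w hu hw x y; rewrite SM !LM hu hw.
- move=> i x y; rewrite (antipode_kV_int hS).
  (* The adjunction for k^-1 is that for k with x replaced by k^-1 x and y by k y. *)
  have := hk i (L (bc (kV_int i)) x) (L (bc (k_int i)) y).
  rewrite (antipode_k_int hS) -!LM base_change_k_kV base_change_kV_k.
  by rewrite -cst1 !Lc !scale1r.
Qed.

Lemma vb_label (k : {ffun 'I_1 -> 'I_N}) : tbasis kappa k = vb kappa n (k ord0).+1.
Proof.
rewrite /vb; congr tbasis; apply/ffunP => i; rewrite ffunE (ord1 i).
by apply: val_inj; rewrite /= inordK.
Qed.

Lemma left_adjoint_vb u :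
    (forall j l, (0 < j <= N)%N -> (0 < l <= N)%N ->
      form (L u (vb kappa n j)) (vb kappa n l) =
      form (vb kappa n j) (L (S u) (vb kappa n l))) ->
  left_adjoint 1 u.
Proof.
move=> h; apply: left_adjoint_basis => // k l; rewrite !vb_label; apply: h.
  by rewrite ltn_ord.
by rewrite ltn_ord.
Qed.

Lemma k_act_neq0 i j : k_act n q i j != 0.
Proof. by rewrite /k_act; do !case: ifP => _ //; rewrite ?invr_neq0 ?oner_neq0. Qed.

(** The vectors v_j and v_(j') have opposite weights, which is the invariance of the form under
    k. *)
Lemma k_act_prm i j : (0 < i <= n)%N -> (0 < j <= N)%N ->
  k_act n q i j * k_act n q i (n.*2.+2 - j) = 1.
Proof.
move=> hi hj; rewrite /k_act /prm; case: ifP => hin.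
  case: (eqVneq j i) => ?; last case: (eqVneq j (n.*2.+2 - i.+1)%N) => ?;
    last case: (eqVneq j i.+1) => ?; last case: (eqVneq j (n.*2.+2 - i)%N) => ?;
    by decide_eqs; rewrite /= ?mulr1 ?mulfV ?mulVf.
case: (eqVneq j n) => ?; last case: (eqVneq j (n.*2.+2 - n)%N) => ?;
  by decide_eqs; rewrite /= ?mulr1 ?mulfV ?mulVf.
Qed.

Lemma left_adjoint_natural u : left_adjoint 1 u.
Proof.
case: (hL.1 1%N isT) => lin Lc _ LM; case: hV => _ hVe hVf hVk.
have linZ u' a (x : tpow kappa n 1) : L u' (a *: x) = a *: L u' x.
  exact: linear_scale (lin u').
have Lk i j m : (0 < j <= N)%N -> L (bc (k_int i) ^+ m) (vb kappa n j) =
    k_act n q i.+1 j ^+ m *: vb kappa n j.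
  move=> hj; elim: m => [|m IH]; first by rewrite !expr0 -cst1 Lc.
  by rewrite !exprSr LM hVk // linZ IH scalerA mulrC.
have hk i : left_adjoint 1 (bc (k_int i)).
  apply: left_adjoint_vb => j l hj hl; rewrite (antipode_k_int hS) hVk //.
  (* [natural_rep] describes k only; the action of its inverse is recovered from k^-1 k = 1. *)
  have -> : L (bc (kV_int i)) (vb kappa n l) = (k_act n q i.+1 l)^-1 *: vb kappa n l.
    apply: (scalerI (k_act_neq0 i.+1 l)); rewrite scalerA mulfV ?k_act_neq0 //.
    by rewrite -linZ -hVk // -LM base_change_kV_k -cst1 Lc.
  rewrite formZl formZr (form_vb qh hq0) //; case: eqP => hjl; last by rewrite !mulr0.
  have hji : (n.*2.+2 - j)%N = l by lia.
  have := @k_act_prm i.+1 j (ltn_ord i) hj; rewrite hji => hk.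
  by rewrite -[k_act n q i.+1 j](mulfK (k_act_neq0 i.+1 l)) hk mul1r.
(* Carries the factor k^-m of S(e^(m)) over to the left argument, the form in which
   [form_e_divpow_act] is stated. *)
have hkX i m (x y : tpow kappa n 1) :
    form x (L (bc (kV_int i) ^+ m) y) = form (L (bc (k_int i) ^+ m) x) y.
  elim: m x => [|m IH] x; first by rewrite !expr0 -cst1 !Lc !scale1r.
  have := hk i x (L (bc (kV_int i) ^+ m) y); rewrite (antipode_k_int hS) exprS LM => <-.
  by rewrite IH -LM -exprSr.
apply: left_adjoint_all => // i m; apply: left_adjoint_vb => j l hj hl.
- rewrite (antipode_e_int hS) LM Lc LM hVe // formZr hkX Lk // formZl hVe //.
  by rewrite (form_e_divpow_act hqh hq0) // ltn_ord.
- rewrite (antipode_f_int hS) LM Lc LM Lk // formZr linZ formZr !hVf //.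
  by rewrite (form_f_divpow_act hqh hq0) // ltn_ord.
Qed.

Lemma L_castt s t (e : s = t) u x : L u (castt e x) = castt e (L u x).
Proof. by case: t / e; rewrite !castt_id. Qed.

(** The left argument is split as V (x) V^(x)s and the right one as V^(x)s (x) V. If Delta(u) is a
    sum of a (x) b, then S(b) (x) S(a) acts on the right, and [form_tcat] separates the adjunction
    of a on V from that of b on V^(x)s. *)
Lemma left_adjoint_flip s u : (0 < s)%N -> (forall w, left_adjoint s w) ->
  coproduct_flip_Uk S D u -> left_adjoint (1 + s) u.
Proof.
move=> hs IH [ps h1 h2]; apply: left_adjoint_basis => // k l.
rewrite -(index_catK k) tbasis_cat.
pose e := addnC s 1.
have -> : tbasis kappa l =
    castt e (tbasis kappa ([ffun i => l (cast_ord e i)] : {ffun 'I_(s + 1) -> 'I_N})).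
  rewrite castt_basis; congr tbasis; apply/ffunP => i; rewrite !ffunE.
  by rewrite cast_ordKV.
rewrite -(index_catK [ffun i => _]) tbasis_cat L_castt.
move: (tbasis _ _) (tbasis _ _) (tbasis _ _) (tbasis _ _) => x x' y' y.
rewrite (hL.2 1%N s isT hs _ _ h1).
rewrite (hL.2 s 1%N hs isT _ [seq (S p.2, S p.1) | p <- ps]); last by rewrite big_map.
rewrite big_map castt_sum form_suml form_sumr; apply: eq_bigr => p _ /=.
by rewrite !form_tcat left_adjoint_natural IH.
Qed.

Lemma left_adjoint_tensor s u : (0 < s)%N -> left_adjoint s u.
Proof.
case: s => // s _; elim: s u => [|s IH] u; first exact: left_adjoint_natural.
have hflip := left_adjoint_flip (ltn0Sn s) IH.
apply: (@left_adjoint_all s.+2) => // [i m|i m|i]; apply: hflip;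
  apply: coproduct_flip_base_change => // Dv Sv hDv hSv.
- exact: coproduct_flip_e_divpow.
- exact: coproduct_flip_f_divpow.
- exact: coproduct_flip_kU.
Qed.

End LeftAdjoint.

(** * Invariance under the BMW algebra, and the isomorphism *)

Lemma right_adjoint (kappa : fieldType) (n r : nat) (q qh rh : kappa)
    (R : tpow kappa n r -> BMW rh q r -> tpow kappa n r)
    (sigma : BMW rh q r -> BMW rh q r) :
    qh ^+ 2 = q -> q != 0 -> BMW_action qh R -> BMW_flip sigma ->
  forall b x y, form (form_coef qh) (R x b) y = form (form_coef qh) x (R y (sigma b)).
Proof.
move=> hqh hq0 [[lin Rc RD RM] hT hE] [[sc sD sM] _ sT sE].
(* T_i and E_i are treated alike: each acts through a symmetric matrix, and the flip sends the
   position i to its mirror image. *)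
have gen (M : 'I_n.*2.+1 -> 'I_n.*2.+1 -> 'M[kappa]_n.*2.+1) i u w :
    form_symmetric qh M -> (forall x, R x u = on_factors M i x) ->
    (forall x, R x w = on_factors M (rev_ord i) x) ->
    forall x y, form (form_coef qh) (R x u) y = form (form_coef qh) x (R y w).
  move=> hM hu hw; apply: form_adjoint_basis; [exact: lin|exact: lin|] => k l.
  by rewrite hu hw; apply: (form_on_factors hqh hq0).
apply: presented_ind => [a|[i|i]|u w hu hw|u w hu hw] x y.
- by rewrite sc !Rc formZl formZr.
- rewrite [sigma _]sT; apply: (gen (Rcheck q qh) i) => [|z|z]; try exact: hT.
  exact: (Rcheck_symmetric hqh hq0).
- rewrite [sigma _]sE; apply: (gen (Emap qh) i) => [|z|z]; try exact: hE.
  exact: (Emap_symmetric hqh hq0).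
- by rewrite sD !RD formDl formDr hu hw.
- by rewrite sM !RM hw hu.
Qed.

Theorem corollary3p2 (kappa : fieldType) (n r : nat) (q qh : kappa)
    (hn : (0 < n)%N) (hr : (0 < r)%N)
    (hqh : qh ^+ 2 = q) (hq0 : q != 0) (hq2 : q ^+ 2 != 1)
    (Delta : Uk qh n -> tensor_alg (Uk qh n) (Uk qh n))
    (hDelta : is_coproduct Delta)
    (S : Uk qh n -> Uk qh n) (hS : is_antipode S)
    (L : forall s, Uk qh n -> tpow kappa n s -> tpow kappa n s)
    (hV : natural_rep q (L 1%N)) (hL : tensor_power_modules Delta L)
    (R : tpow kappa n r -> BMW (q ^+ (2 * n)) q r -> tpow kappa n r)
    (hR : BMW_action qh R)
    (sigma : BMW (q ^+ (2 * n)) q r -> BMW (q ^+ (2 * n)) q r)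
    (hsigma : BMW_flip sigma) :
  bimodule_iso (L r) R (dual_left S (L r)) (dual_right sigma R).
Proof.
pose c := form_coef (n := n) qh.
pose theta : {linear tpow kappa n r -> dual (tpow kappa n r)} :=
  HB.pack (@form_dual kappa n c r)
    (GRing.isLinear.Build _ _ _ _ _ (@form_dual_linear kappa n c r)).
exists theta; first exact/form_dual_bij/(form_coef_neq0 hqh hq0).
(* The dual actions apply [linfun] to bare functions; evaluating the result requires the linearity
   of the underlying action. *)
have dualE (f : tpow kappa n r -> tpow kappa n r) x y : linear f ->
    linfun (fun z => form_dual c x (f z) : kappa^o) y = form c x (f y).
  move=> hf; rewrite -form_dualE.
  pose F : {linear tpow kappa n r -> kappa^o} :=
    HB.pack (fun z => form_dual c x (f z) : kappa^o) (GRing.isLinear.Build _ _ _ _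
      (fun z => form_dual c x (f z) : kappa^o)
      (fun a u w => etrans (congr1 (form_dual c x) (hf a u w)) (linearP _ a _ _))).
  exact: (lfunE F).
case: (hL.1 r hr) => Llin _ _ _; case: (hR) => -[Rlin _ _ _] _ _.
(* Evaluated at y, the two intertwining conditions are exactly the two adjunctions. *)
split=> [a x|x b]; apply/lfunP => y; rewrite dualE ?form_dualE //.
- exact: (left_adjoint_tensor hqh hq0 hDelta hS hV hL).
- exact: (right_adjoint hqh hq0 hR hsigma).
Qed.
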